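(* Let $1<p<\infty$ and let $\omega:\mathbb{R}_+\to\mathbb{R}_+$ be continuous. Then: (i) If $\omega\in B_p(0)\setminus B_p(\infty)$, then $D^{1,p}_0(\mathbb{R}_+,\omega)=\mathcal{R}^0_{p,\omega}(0)$. (ii) If $\omega\in B_p(\infty)\setminus B_p(0)$, then $D^{1,p}_0(\mathbb{R}_+,\omega)=\mathcal{R}^\infty_{p,\omega}(0)$. (iii) If $\omega\notin B_p(0)\cup B_p(\infty)$, then $D^{1,p}_0(\mathbb{R}_+,\omega)=D^{1,p}(\mathbb{R}_+,\omega)$. (iv) If $\omega\in B_p(0)\cap B_p(\infty)$, then $D^{1,p}_0(\mathbb{R}_+,\omega)=\mathcal{R}^0_{p,\omega}(0)\cap\mathcal{R}^\infty_{p,\omega}(0)$.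
   Context: $\mathbb{R}_+=(0,\infty)$. $\omega\in B_p(0)$ means $\int_0^1\omega^{-1/(p-1)}\,d\tau<\infty$; $\omega\in B_p(\infty)$ means $\int_1^\infty\omega^{-1/(p-1)}\,d\tau<\infty$. $L^p(\mathbb{R}_+,\omega)$ is the space of measurable $f$ with $\|f\|_{L^p(\mathbb{R}_+,\omega)}=\big(\int_0^\infty|f|^p\omega\,dt\big)^{1/p}<\infty$. The weighted Dirichlet space $D^{1,p}(\mathbb{R}_+,\omega)$ consists of all locally absolutely continuous $u:\mathbb{R}_+\to\mathbb{R}$ with $\|u'\|_{L^p(\mathbb{R}_+,\omega)}<\infty$. $D^{1,p}_0(\mathbb{R}_+,\omega)$ is the set of all $u\in D^{1,p}(\mathbb{R}_+,\omega)$ for which there is a sequence $\{\phi_n\}\subseteq C_0^\infty(\mathbb{R}_+)$ (smooth functions with compact support in $(0,\infty)$) such that $\phi_n'\to u'$ in $L^p(\mathbb{R}_+,\omega)$ and $\phi_n\to u$ uniformly on compact subsets of $\mathbb{R}_+$. Further, $$\mathcal{R}^0_{p,\omega}(0)=\Big\{u\in D^{1,p}(\mathbb{R}_+,\omega):\ u(t)=\int_0^t u'(\tau)\,d\tau\ \text{ for all }t>0\Big\},$$ $$\mathcal{R}^\infty_{p,\omega}(0)=\Big\{u\in D^{1,p}(\mathbb{R}_+,\omega):\ u(t)=\int_t^\infty v(\tau)\,d\tau\ \text{ for all }t>0,\ \text{for some }v\in L^p(\mathbb{R}_+,\omega)\Big\}.$$ *)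

(* Defs.v *)
From mathcomp Require Import all_boot all_order all_algebra.
From mathcomp Require Import all_classical all_reals all_analysis.

Set Implicit Arguments.
Unset Strict Implicit.
Unset Printing Implicit Defensive.

Import Order.TTheory GRing.Theory Num.Theory.
Import numFieldNormedType.Exports.

Local Open Scope ring_scope.
Local Open Scope classical_set_scope.

(* Functions on the half-line (0, +oo) are represented by total functions
   R -> R, the values outside (0, +oo) being irrelevant: only test functions are
   constrained there, where they are extended by zero. *)

Definition Bp0 {R : realType} (p : R) : set (R -> R) :=
  [set w : R -> R | (\int[lebesgue_measure]_(t in `]0%R, 1%R])
             (w t `^ (- (p - 1)^-1))%:E < +oo)%E].

Definition Bpinfty {R : realType} (p : R) : set (R -> R) :=
  [set w : R -> R | (\int[lebesgue_measure]_(t in `[1%R, +oo[)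
             (w t `^ (- (p - 1)^-1))%:E < +oo)%E].

Definition wLnorm {R : realType} (p : R) (w f : R -> R) : \bar R :=
  ((\int[lebesgue_measure]_(t in `]0%R, +oo[) (`|f t| `^ p * w t)%:E)
    `^ p^-1)%E.

Definition wLp {R : realType} (p : R) (w : R -> R) : set (R -> R) :=
  [set f : R -> R | measurable_fun (`]0, +oo[ : set R) f /\ (wLnorm p w f < +oo)%E].

Definition abs_cont {R : realType} (a b : R) (u : R -> R) : Prop :=
  forall e : R, 0 < e -> exists2 d : R, 0 < d &
    forall (n : nat) (x y : 'I_n -> R),
      (forall i, [/\ a <= x i, x i <= y i & y i <= b]) ->
      trivIset [set: 'I_n] (fun i => `]x i, y i[%classic) ->
      \sum_(i < n) (y i - x i) < d ->
      \sum_(i < n) `|u (y i) - u (x i)| < e.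

Definition loc_abs_cont {R : realType} (u : R -> R) : Prop :=
  forall a b : R, 0 < a -> a <= b -> abs_cont a b u.

(* A locally absolutely continuous function is differentiable almost
   everywhere on (0, +oo); where it is not, u^`() takes a default value. *)
Definition Dirichlet {R : realType} (p : R) (w : R -> R) : set (R -> R) :=
  [set u : R -> R | loc_abs_cont u /\ wLp p w u^`()].

Definition test_function {R : realType} : set (R -> R) :=
  [set phi : R -> R |
    [/\ forall n t, derivable phi^`(n) t 1,
        compact (closure [set t | phi t != 0]) &
        closure [set t | phi t != 0] `<=` `]0, +oo[]].

Definition Dirichlet0 {R : realType} (p : R) (w : R -> R) : set (R -> R) :=
  [set u : R -> R | Dirichlet p w u /\
    exists phi : nat -> R -> R,
      [/\ forall n, test_function (phi n),
          wLnorm p w ((phi n)^`() \- u^`()) @[n --> \oo] --> 0%E &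
          forall K : set R, compact K -> K `<=` `]0, +oo[ ->
            {uniform K, phi @ \oo --> u}]].

Definition Rzero {R : realType} (p : R) (w : R -> R) : set (R -> R) :=
  [set u : R -> R | Dirichlet p w u /\
    forall t : R, 0 < t ->
      lebesgue_measure.-integrable `]0, t] (EFin \o u^`()) /\
      u t = \int[lebesgue_measure]_(s in `]0, t]) (u^`())%classic s].

Definition Rinfty {R : realType} (p : R) (w : R -> R) : set (R -> R) :=
  [set u : R -> R | Dirichlet p w u /\
    exists2 v : R -> R, wLp p w v &
      forall t : R, 0 < t ->
        lebesgue_measure.-integrable `[t, +oo[ (EFin \o v) /\
        u t = \int[lebesgue_measure]_(s in `[t, +oo[) v s].

(* Main.v *)
From HB Require Import structures.
Require Import Defs.
From mathcomp Require Import all_boot all_order all_algebra.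
From mathcomp Require Import all_classical all_reals all_analysis.
From mathcomp Require Import measurable_realfun lebesgue_integral_differentiation.
From mathcomp Require Import ring lra.

Set Implicit Arguments.
Unset Strict Implicit.
Unset Printing Implicit Defensive.

Import Order.TTheory GRing.Theory Num.Theory.
Import numFieldNormedType.Exports.

Local Open Scope ring_scope.
Local Open Scope classical_set_scope.

(** Let s = w^(-1/(p-1)) be the dual weight, whose integrability near 0 and near
    infinity defines B_p(0) and B_p(infinity). Everything rests on two facts about
    a function f of finite energy, the integral of |f|^p w, on a subset D of the
    half-line.

    - If s is integrable on D, small energy forces a small integral of |f|
      ([L1_small_of_energy]). This follows from the pointwise inequality
      |f| <= r s + r^(1-p) |f|^p w, valid for every r > 0.

    - If s is not integrable on D, the integral of f over D is unrelated to its
      energy: multiples of s, cut off to large boxes, have any prescribed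
      integral and arbitrarily small energy ([cheap_corrector]).

    A test function is the integral of its derivative from 0, and minus that
    integral up to infinity. By the first fact these formulas pass to the limit at
    each end where s is integrable, which gives the inclusions of D_0 in the
    spaces of functions recovered from their derivatives ([Dirichlet0_Rzero],
    [Dirichlet0_Rinfty]).

    Conversely, let u be in the Dirichlet space. It suffices to approximate u' in
    energy by smooth functions g with compact support in the half-line whose
    integrals over ]0, 1] and ]1, +oo[ are close to u 1 and - u 1: after a
    small correction g has mean zero, and its primitive is a test function that is
    close to u at 1, hence locally uniformly. On each of the two pieces, either s
    is not integrable and the integral can be adjusted for free, or the hypothesis
    on u says that the integral of u' has the desired value already, so that
    cutting off is enough ([half_approximation]). This treats the four cases
    uniformly ([Dirichlet0_of_boundary]).

    Comparing u with such primitives, as well as evaluating the integral of u' up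
    to infinity when u is only known to be the integral of some v
    ([Rinfty_boundary]), requires the fundamental theorem of calculus for locally
    absolutely continuous functions ([loc_abs_cont_FTC]). It is obtained by writing
    u as a difference of monotone absolutely continuous functions by means of its
    total variation; the Lebesgue-Stieltjes measure of such a function is
    absolutely continuous with respect to Lebesgue measure, and its
    Radon-Nikodym density is the derivative, by Lebesgue's differentiation
    theorem. *)

(** * Absolutely continuous functions have absolutely continuous variation *)

(** Equal steps, continued beyond n so that monotonicity holds for all indices. *)
Lemma fine_partition {R : realType} (a b d : R) : a <= b -> 0 < d ->
  exists n (pt : nat -> R), [/\ pt 0%N = a, pt n = b,
    forall i, pt i <= pt i.+1, forall i, pt i.+1 - pt i < d &
    forall i, (i <= n)%N -> a <= pt i <= b].
Proof.
move=> ab d0.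
have [n nd] : exists n : nat, (b - a) / n.+1%:R < d.
  exists (Num.truncn ((b - a) / d)).
  by rewrite ltr_pdivrMr// mulrC -ltr_pdivrMr// truncnS_gt.
pose pt i : R := a + (b - a) * i%:R / n.+1%:R.
have n0 : (0 : R) < n.+1%:R by [].
have ptS i : pt i.+1 = pt i + (b - a) / n.+1%:R.
  by rewrite /pt -natr1 mulrDr mulr1 mulrDl addrA.
have h0 : 0 <= (b - a) / n.+1%:R by rewrite divr_ge0 ?subr_ge0// ltW.
have ptle i : pt i <= pt i.+1 by rewrite ptS; exact: ler_wpDr.
have pt_mono i j : (i <= j)%N -> pt i <= pt j.
  move=> ij; rewrite -(subnK ij).
  by elim: (j - i)%N => [//|m ihm]; rewrite addSn; exact: le_trans (ptle _).
have pt0 : pt 0%N = a by rewrite /pt mulr0 mul0r addr0.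
have ptn : pt n.+1 = b by rewrite /pt mulfK ?(lt0r_neq0 n0)//; lra.
exists n.+1, pt; split => //.
- by move=> i; rewrite ptS addrC addKr.
- by move=> i ile; rewrite -{1}pt0 -{1}ptn !pt_mono.
Qed.

Section total_variation_of_absolutely_continuous.
Context {R : realType}.
Implicit Types (a b e d : R) (u : R -> R) (s L M : seq (R * R)).

(** A boolean substitute for the disjointness of open intervals. For nondegenerate
    intervals it is the same thing; unlike trivIset it can be handled with pairwise,
    so that finite families can be cut and glued as lists. *)
Definition itv_sep (I J : R * R) : bool := (I.2 <= J.1) || (J.2 <= I.1).

Definition separated a b s : bool :=
  all (fun I => [&& a <= I.1, I.1 <= I.2 & I.2 <= b]) s && pairwise itv_sep s.

(** Families indexed by ordinals can be traded for lists of separated intervals.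
    Degenerate intervals must be dropped on the way: they are disjoint from any
    interval but need not be separated from it, and they contribute nothing. *)
Lemma abs_contP a b u : abs_cont a b u <-> forall e, 0 < e ->
  exists2 d, 0 < d & forall s, separated a b s ->
    \sum_(I <- s) (I.2 - I.1) < d -> \sum_(I <- s) `|u I.2 - u I.1| < e.
Proof.
split => acu e e0; have [d d0 H] := acu e e0; exists d => //.
  move=> s /andP[/allP sab sep].
  have := H (size s) (fun i => (nth (0, 0) s i).1) (fun i => (nth (0, 0) s i).2).
  rewrite (big_nth (0, 0)) big_mkord => + sd; rewrite (big_nth (0, 0)) big_mkord.
  apply => //.
  - by move=> i; have /and3P[-> -> ->] := sab _ (mem_nth (0, 0) (ltn_ord i)).
  - have dis (i j : 'I_(size s)) : (i < j)%N ->
        `](nth (0, 0) s i).1, (nth (0, 0) s i).2[%classic `&`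
        `](nth (0, 0) s j).1, (nth (0, 0) s j).2[%classic = set0.
      move=> ij; have /(pairwiseP (0, 0))/(_ i j) := sep.
      rewrite !inE !ltn_ord ij => /(_ isT isT isT) /orP sepij.
      apply/seteqP; split => // z [] /=.
      rewrite !in_itv/= => /andP[z1 z2] /andP[z3 z4].
      by case: sepij => h; lra.
    apply/trivIsetP => i j _ _; rewrite neq_ltn => /orP[|] /dis //.
    by rewrite setIC.
move=> n x y xy dis sd.
pose P i := x i < y i.
have Psum (F : 'I_n -> R) : (forall i, x i = y i -> F i = 0) ->
    \sum_(i < n) F i = \sum_(I <- [seq i <- enum 'I_n | P i]) F I.
  move=> F0; rewrite big_filter big_enum_cond /= [LHS](bigID P) /=.
  rewrite [X in _ + X]big1 ?addr0// => i; rewrite /P -leNgt => yx.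
  by apply: F0; have [_ xyi _] := xy i; apply/eqP; rewrite eq_le xyi.
have := H [seq (x i, y i) | i <- [seq i <- enum 'I_n | P i]].
rewrite !big_map -!Psum => [|i ->|i ->]; rewrite ?subrr ?normr0//; apply => //.
apply/andP; split.
  by apply/allP => I /mapP[i _ ->] /=; have [-> -> ->] := xy i.
rewrite pairwise_map.
have := filter_uniq P (enum_uniq 'I_n); rewrite uniq_pairwise.
apply: (@sub_in_pairwise _ [in [seq i <- enum 'I_n | P i]]) => [i j|];
  last by apply/allP => i.
rewrite ?inE ?mem_filter /= => /andP[Pi _] /andP[Pj _] ij.
rewrite /itv_sep /=; apply: contraT; rewrite negb_or -!ltNge => /andP[xjyi xiyj].
have /trivIsetP/(_ i j I I ij) := dis; move/seteqP => [+ _].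
(* two nondegenerate intervals that are not separated share this midpoint *)
pose z := (Num.max (x i) (x j) + Num.min (y i) (y j)) / 2.
have zz : Num.max (x i) (x j) < Num.min (y i) (y j).
  by rewrite gt_max !lt_min; apply/andP; split; apply/andP; split.
move=> /(_ z); case; split; rewrite /= in_itv/=.
  apply/andP; split.
    by rewrite (le_lt_trans _ (midf_lt zz).1)// le_max lexx.
  by rewrite (lt_le_trans (midf_lt zz).2)// ge_min lexx.
apply/andP; split.
  by rewrite (le_lt_trans _ (midf_lt zz).1)// le_max lexx orbT.
by rewrite (lt_le_trans (midf_lt zz).2)// ge_min lexx orbT.
Qed.

(** The modulus of absolute continuity of u also controls its total variation:
    refining the intervals of L by partitions gives families that are still
    separated and have the same total length. The intervals are processed one at a
    time, the list M of the proof holding the pieces already cut; this avoids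
    indexing over all partitions simultaneously. *)
Lemma sum_total_variation_le a b u e d :
  (forall s, separated a b s ->
    \sum_(I <- s) (I.2 - I.1) < d -> \sum_(I <- s) `|u I.2 - u I.1| < e) ->
  forall L, separated a b L -> \sum_(I <- L) (I.2 - I.1) < d ->
    (\sum_(I <- L) total_variation I.1 I.2 u <= e%:E)%E.
Proof.
move=> H L sepL Ld.
suff main : forall M, separated a b (M ++ L) ->
    \sum_(I <- M ++ L) (I.2 - I.1) < d ->
    (\sum_(I <- L) total_variation I.1 I.2 u +
      (\sum_(I <- M) `|u I.2 - u I.1|)%:E <= e%:E)%E.
  by have := main [::] sepL Ld; rewrite big_nil adde0.
elim: L {sepL Ld} => [|[x y] L ih] M.
  rewrite cats0 big_nil add0e lee_fin => sM Md.
  exact/ltW/(H M).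
have inner (t : seq R) : forall x M, path <%R x t ->
    separated a b (M ++ (x, last x t) :: L) ->
    \sum_(I <- M ++ (x, last x t) :: L) (I.2 - I.1) < d ->
    (\sum_(I <- L) total_variation I.1 I.2 u +
      (\sum_(I <- M) `|u I.2 - u I.1| +
       \sum_(I <- zip t (x :: t)) `|u I.1 - u I.2|)%:E <= e%:E)%E.
  elim: t {x y M} => [|c t ihs] x M /=.
    rewrite big_nil addr0 => _ sep le; apply: ih.
      move: sep; rewrite /separated !all_cat /= !pairwise_cat /= allrel_consr.
      by move=> /andP[/and3P[-> _ ->]] /and3P[/andP[_ ->] -> /andP[_ ->]].
    by move: le; rewrite !big_cat/= big_cons/= subrr add0r.
  move=> /andP[xc cs] sep le.
  have cl : c <= last c t.
    by apply: (@itv_partition_le _ _ c _ t); split.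
  (* the first piece ]x, c] of the partition moves to the list M *)
  have -> : \sum_(I <- M) `|u I.2 - u I.1| +
      \sum_(I <- (c, x) :: zip t (c :: t)) `|u I.1 - u I.2| =
      \sum_(I <- (x, c) :: M) `|u I.2 - u I.1| +
      \sum_(I <- zip t (c :: t)) `|u I.1 - u I.2|.
    by rewrite !big_cons /=; ring.
  apply: ihs => //.
    move: sep; rewrite /separated /= !all_cat /= !pairwise_cat /= !allrel_consr.
    move=> /andP[/and3P[-> /and3P[h1 h2 h3] ->]] /and4P[/andP[h4 ->] -> h5 ->].
    rewrite h1 cl h3 (ltW xc) (le_trans cl h3) (le_trans h1 (ltW xc)) /= !andbT.
    apply/andP; split; first (apply/and3P; split); last (apply/andP; split).
    - move: h4; apply: sub_all => J; rewrite /itv_sep /= => /orP[->|h].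
        by rewrite orbT.
      by rewrite (le_trans cl h).
    - by rewrite /itv_sep /= lexx.
    - move: h5; apply: sub_all => J; rewrite /itv_sep /= => /orP[h|->].
        by rewrite (le_trans cl h).
      by rewrite orbT.
    - move: h4; apply: sub_all => J; rewrite /itv_sep /= => /orP[h|->//].
        by rewrite (le_trans h (ltW xc)).
      by rewrite orbT.
    - move: h5; apply: sub_all => J; rewrite /itv_sep /= => /orP[->//|h].
      by rewrite (le_trans h (ltW xc)) orbT.
  by move: le; rewrite !big_cat/= !big_cons; lra.
move=> sep le.
have xy : x <= y.
  by move: sep; rewrite /separated all_cat /= => /andP[/and3P[_ /and3P[]]].
have C : (\sum_(I <- L) total_variation I.1 I.2 u + (\sum_(I <- M) `|u I.2 - u I.1|)%:E <= e%:E)%E.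
  apply: ih.
    move: sep; rewrite /separated !all_cat /= !pairwise_cat /= allrel_consr.
    by move=> /andP[/and3P[-> _ ->]] /and3P[/andP[_ ->] -> /andP[_ ->]].
  by move: le; rewrite !big_cat/= big_cons/=; lra.
have L0 : (0 <= \sum_(I <- L) total_variation I.1 I.2 u)%E.
  rewrite big_seq; apply: sume_ge0 => J JL; apply: total_variation_ge0.
  move: sep; rewrite /separated all_cat /= => /andP[/and3P[_ _ /allP/(_ _ JL)/and3P[]]] //.
have Lfin : (\sum_(I <- L) total_variation I.1 I.2 u)%E \is a fin_num.
  rewrite ge0_fin_numE//; apply: le_lt_trans (ltry e); apply: le_trans C.
  by rewrite leeDl// lee_fin sumr_ge0.
rewrite big_cons /= -addeA addeC -leeBrDl ?fin_numD ?Lfin//.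
apply: ge_ereal_sup => _ [_ [t /[dup] pt [tp /eqP tl] <-] <-].
rewrite leeBrDl ?fin_numD ?Lfin//.
rewrite (variation_zip _ pt) -addeA -EFinD.
by apply: inner => //; rewrite tl.
Qed.

(** The interval is cut into pieces so short that u has variation at most 1 on each. *)
Lemma abs_cont_bounded_variation a b u : a <= b -> abs_cont a b u ->
  bounded_variation a b u.
Proof.
move=> ab /abs_contP acu; apply/bounded_variationP => //.
have [d d0 H] := acu 1 ltr01.
have [n [pt [pt0 ptn ptle ptd ptab]]] := fine_partition ab d0.
suff : forall i, (i <= n)%N -> total_variation a (pt i) u \is a fin_num.
  by move/(_ _ (leqnn _)); rewrite ptn.
elim=> [_|i ih ile]; first by rewrite pt0 total_variationxx.
have /andP[ai ib] := ptab _ (ltnW ile); have /andP[aS Sb] := ptab _ ile.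
rewrite (@total_variationD _ _ _ (pt i))// fin_numD ih ?(ltnW ile)//=.
rewrite ge0_fin_numE; last exact: total_variation_ge0.
apply: (@le_lt_trans _ _ 1%:E); last exact: ltry.
have := @sum_total_variation_le a b u 1 d H [:: (pt i, pt i.+1)].
rewrite !big_cons !big_nil /= addr0 adde0; apply; last exact: ptd.
by rewrite /separated /= ai ptle Sb.
Qed.

Lemma total_variationB a b u x y : a <= x -> x <= y -> y <= b ->
  bounded_variation a b u ->
  total_variation x y u =
  (fine (total_variation a y u) - fine (total_variation a x u))%:E.
Proof.
move=> ax xy yb bv.
have fx : total_variation a x u \is a fin_num.
  by apply/bounded_variationP => //; apply: bounded_variationl bv; lra.
have fy : total_variation a y u \is a fin_num.
  by apply/bounded_variationP; [|apply: bounded_variationl bv]; lra.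
rewrite EFinB !fineK// (total_variationD u ax xy) addeAC subee ?add0e//.
Qed.

Lemma abs_cont_total_variation a b u : a <= b -> abs_cont a b u ->
  abs_cont a b (fun x => fine (total_variation a x u)).
Proof.
move=> ab acu; have bv := abs_cont_bounded_variation ab acu.
move/abs_contP : acu => acu; apply/abs_contP => e e0.
have e20 : 0 < e / 2 by lra.
have [d d0 H] := acu _ e20; exists d => // s seps sd.
have := sum_total_variation_le H seps sd.
rewrite big_seq.
rewrite (@eq_bigr _ _ _ _ _ _ _ (fun I => (`|fine (total_variation a I.2 u) -
    fine (total_variation a I.1 u)|)%:E)); last first.
  move=> I Is; have /andP[/allP/(_ I Is)/and3P[aI II Ib] _] := seps.
  rewrite (total_variationB aI II Ib bv) ger0_norm//.
  by rewrite -lee_fin -(total_variationB aI II Ib bv) total_variation_ge0.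
rewrite -big_seq sumEFin lee_fin => h; apply: le_lt_trans h _; lra.
Qed.

Lemma abs_contB a b u v : abs_cont a b u -> abs_cont a b v ->
  abs_cont a b (fun x => u x - v x).
Proof.
move=> acu acv e e0; have e20 : 0 < e / 2 by lra.
have [d1 d10 H1] := acu _ e20; have [d2 d20 H2] := acv _ e20.
exists (Num.min d1 d2) => [|n x y xy dis]; rewrite lt_min ?d10// => /andP[s1 s2].
apply: (@le_lt_trans _ _ (\sum_(i < n) (`|u (y i) - u (x i)| + `|v (y i) - v (x i)|))).
  apply: ler_sum => i _.
  rewrite (_ : _ - _ = (u (y i) - u (x i)) - (v (y i) - v (x i))); last by ring.
  exact: ler_normB.
rewrite big_split /=.
have := H1 n x y xy dis s1; have := H2 n x y xy dis s2; lra.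
Qed.

(** Together with the next lemma, this writes u as the difference T - (T - u) of two
    nondecreasing functions, both absolutely continuous, where T is the variation
    of u from a. *)
Lemma total_variation_sub_nondecreasing a b u x y : a <= x -> x <= y -> y <= b ->
  bounded_variation a b u ->
  fine (total_variation a x u) - u x <= fine (total_variation a y u) - u y.
Proof.
move=> ax xy yb bv; have := total_variation_ge u xy.
rewrite (total_variationB ax xy yb bv) lee_fin => h.
have := ler_norm (u y - u x); lra.
Qed.

Lemma total_variation_fine_nondecreasing a b u x y : a <= x -> x <= y -> y <= b ->
  bounded_variation a b u ->
  fine (total_variation a x u) <= fine (total_variation a y u).
Proof.
move=> ax xy yb bv; have := total_variation_ge0 u xy.
by rewrite (total_variationB ax xy yb bv) lee_fin subr_ge0.
Qed.

End total_variation_of_absolutely_continuous.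

(** * Densities of monotone absolutely continuous functions *)

Section monotone_absolutely_continuous.
Context {R : realType}.
Notation mu := (@lebesgue_measure R).

(** Composing with clamp a b extends a function on [a, b] by constants; with bounds
    -M and M it truncates a function at height M. *)
Definition clamp (a b x : R) : R := Num.max a (Num.min b x).

Lemma clamp_itv a b x : a <= b -> a <= clamp a b x /\ clamp a b x <= b.
Proof.
move=> ab; rewrite /clamp le_max lexx ge_max ab ge_min lexx; split => //.
Qed.

Lemma clamp_id a b x : a <= x -> x <= b -> clamp a b x = x.
Proof. by move=> ax xb; rewrite /clamp min_r// max_r. Qed.

Lemma clamp_le a b x y : x <= y -> clamp a b x <= clamp a b y.
Proof.
move=> xy; rewrite /clamp ge_max le_max lexx/= le_max; apply/orP; right.
by rewrite le_min !ge_min lexx xy /= orbT.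
Qed.

Lemma clamp_lip a b x y : a <= b -> x <= y -> clamp a b y - clamp a b x <= y - x.
Proof.
move=> ab xy; rewrite /clamp.
have [?|?] := leP b x; have [?|?] := leP b y; rewrite ?maxEle; repeat case: ifPn; rewrite -?ltNge => *; lra.
Qed.

Lemma abs_cont_uniform a b (F : R -> R) : abs_cont a b F -> forall e, 0 < e ->
  exists2 d, 0 < d & forall x y, a <= x -> x <= y -> y <= b -> y - x < d ->
    `|F y - F x| < e.
Proof.
move=> acF e e0; have [d d0 H] := acF e e0; exists d => // x y ax xy yb xyd.
have := H 1%N (fun=> x) (fun=> y); rewrite !big_ord1; apply => //.
by apply/trivIsetP => i j _ _; rewrite !ord1 eqxx.
Qed.

Section density.
Variables (a b : R) (F : R -> R).
Hypotheses (ab : a < b) (acF : abs_cont a b F).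
Hypothesis ndF : forall x y, a <= x -> x <= y -> y <= b -> F x <= F y.

Let G x := F (clamp a b x).

Let ndG : {homo G : x y / x <= y}.
Proof.
move=> x y xy; have [ax xb] := clamp_itv x (ltW ab).
have [ay yb] := clamp_itv y (ltW ab); apply: ndF => //; exact: clamp_le.
Qed.

Let rcG : right_continuous G.
Proof.
move=> x; apply/cvgrPdist_lt => e e0.
have [d d0 H] := abs_cont_uniform acF e0.
near=> y; rewrite distrC; have xy : x <= y by [].
have [ax xb] := clamp_itv x (ltW ab); have [ay yb] := clamp_itv y (ltW ab).
apply: H => //; first exact: clamp_le.
apply: le_lt_trans (clamp_lip (ltW ab) xy) _; rewrite ltrBlDl.
near: y; apply: nbhs_right_lt; lra.
Unshelve. all: by end_near. Qed.

HB.instance Definition _ := isCumulative.Build R _ R G ndG rcG.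

Let ls := lebesgue_stieltjes_measure (G : cumulative R R).

Let lsE x y : x <= y -> ls `]x, y] = (G y - G x)%:E.
Proof.
move=> xy; rewrite /ls /lebesgue_stieltjes_measure /measure_extension.
by rewrite measurable_mu_extE/=; [rewrite wlength_itv_bnd|exact: is_ocitv].
Qed.

Let D : set (measurableTypeR R) := `]a, b].
Let mD : measurable D. Proof. exact: measurable_itv. Qed.
Let lsD : (ls D < +oo)%E. Proof. by rewrite /D lsE ?ltry// ltW. Qed.

Let nu : {finite_measure set (measurableTypeR R) -> \bar R} := mfrestr mD lsD.

Let nuE x y : a <= x -> x <= y -> y <= b -> nu `]x, y]%classic = (F y - F x)%:E.
Proof.
move=> ax xy yb; rewrite /nu /= /mfrestr /mrestr setIidl.
  by apply: etrans (lsE xy) _; rewrite /G !clamp_id//; lra.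
by move=> z /=; rewrite /D /= !in_itv /= => /andP[? ?]; apply/andP; split; lra.
Qed.

Let pt n i : R := a + (b - a) * i%:R / (2 ^ n)%:R.
Let cell n i : set R := `]pt n i, pt n i.+1]%classic.

Let n2 n : (0 : R) < (2 ^ n)%:R. Proof. by rewrite ltr0n expn_gt0. Qed.

Let ptS n i : pt n i.+1 = pt n i + (b - a) / (2 ^ n)%:R.
Proof. by rewrite /pt -natr1 mulrDr mulr1 mulrDl addrA. Qed.

Let h0 n : 0 < (b - a) / (2 ^ n)%:R. Proof. by rewrite divr_gt0 ?subr_gt0. Qed.

Let pt_le n i j : (i <= j)%N -> pt n i <= pt n j.
Proof.
move=> ij; rewrite lerD2l ler_pM2r ?invr_gt0// ler_pM2l ?subr_gt0//.
by rewrite ler_nat.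
Qed.

Let pt0 n : pt n 0 = a. Proof. by rewrite /pt mulr0 mul0r addr0. Qed.

Let pt_last n : pt n (2 ^ n) = b.
Proof. by rewrite /pt mulfK ?(lt0r_neq0 (n2 n))// addrC subrK. Qed.

Let pt_double n i : pt n.+1 (i.*2) = pt n i.
Proof.
rewrite /pt -muln2 expnS natrM natrM; congr (_ + _).
by rewrite invfM !mulrA mulfK.
Qed.

Let cell_split n i : cell n i = cell n.+1 i.*2 `|` cell n.+1 i.*2.+1.
Proof.
rewrite /cell -doubleS !pt_double.
have := @pt_le n.+1 i.*2 i.*2.+1 (leqnSn _); rewrite pt_double => h1.
have := @pt_le n.+1 i.*2.+1 i.*2.+2 (leqnSn _); rewrite -doubleS pt_double => h2.
by rewrite -itv_bndbnd_setU// bnd_simp.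
Qed.

Let cell_cover n x : a < x -> x <= b -> exists2 i, (i < 2 ^ n)%N & cell n i x.
Proof.
move=> ax xb; elim: n => [|n [i ilt]].
  exists 0%N => //; rewrite /cell pt0 -[1%N]/(2 ^ 0)%N pt_last /= in_itv/=.
  by rewrite ax.
rewrite cell_split => -[|] c.
  by exists i.*2 => //; rewrite expnS mul2n ltn_double.
by exists i.*2.+1 => //; rewrite expnS mul2n ltn_Sdouble.
Qed.

Section open_small.
Variables (U : set R) (oU : open U).

Let A n i : set R := if `[< cell n i `<=` U >] then cell n i else set0.
Let V n : set R := \big[setU/set0]_(i < 2 ^ n) A n i.

Let mA n i : measurable (A n i).
Proof. by rewrite /A; case: ifP => // _; exact: measurable_itv. Qed.

Let VP n x : V n x <-> exists i, [/\ (i < 2 ^ n)%N, cell n i x & cell n i `<=` U].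
Proof.
rewrite /V -bigcup_mkord; split.
  move=> [i /= ilt]; rewrite /A; case: asboolP => // cU cx.
  by exists i; split.
move=> [i [ilt cx cU]]; exists i => //; rewrite /A; case: asboolP => //.
Qed.

Let V_nd : {homo V : n m / (n <= m)%N >-> (n <= m)%O}.
Proof.
apply/nondecreasing_seqP => n; apply/subsetPset => x /VP[i [ilt cx cU]].
move: cx cU; rewrite cell_split => -[|] cx cU; apply/VP.
  by exists i.*2; split => //; [rewrite expnS mul2n ltn_double|exact: subset_trans cU].
by exists i.*2.+1; split => //; [rewrite expnS mul2n ltn_Sdouble|exact: subset_trans cU].
Qed.

Let V_cover : D `&` U `<=` \bigcup_n V n.
Proof.
move=> x [/=]; rewrite /D /= in_itv /= => /andP[ax xb] Ux.
have /nbhs_ballP[e /= e0 eU] := open_nbhs_nbhs (conj oU Ux).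
have [n ne] : exists n : nat, (b - a) / (2 ^ n)%:R < e.
  exists (Num.bound ((b - a) / e)).
  rewrite ltr_pdivrMr// mulrC -ltr_pdivrMr//.
  apply: lt_le_trans (archi_boundP _) _.
    by rewrite divr_ge0 ?subr_ge0// ltW.
  by rewrite ler_nat ltnW// ltn_expl.
have [i ilt cx] := cell_cover n ax xb.
exists n => //; apply/VP; exists i; split => // y.
move: cx; rewrite /cell /= !in_itv /= ptS => /andP[x1 x2] /andP[y1 y2].
by apply: eU; rewrite /ball /= ltr_norml; apply/andP; split; lra.
Qed.

(** The dyadic cells contained in an open set U increase to U as the level grows.
    At each level they form a finite disjoint family whose total length is at most
    that of U, so absolute continuity bounds their mass, hence that of U. *)
Lemma nu_open_le e d :
  (forall (n : nat) (x y : 'I_n -> R),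
      (forall i, [/\ a <= x i, x i <= y i & y i <= b]) ->
      trivIset [set: 'I_n] (fun i => `]x i, y i[%classic) ->
      \sum_(i < n) (y i - x i) < d ->
      \sum_(i < n) `|F (y i) - F (x i)| < e) ->
  (mu U < d%:E)%E -> (nu U <= e%:E)%E.
Proof.
move=> H Ud.
have mV n : measurable (V n) by apply: bigsetU_measurable => i _; exact: mA.
have mcup : measurable (\bigcup_n V n) by exact: bigcup_measurable.
have cvg := @nondecreasing_cvg_mu _ _ _ nu V mV mcup V_nd.
have -> : nu U = nu (D `&` U).
  by rewrite /nu /= /mfrestr /mrestr -setIA [U `&` D]setIC setIA setIid setIC.
apply: (@le_trans _ _ (nu (\bigcup_n V n))).
  apply: le_measure; rewrite ?inE//.
  by apply: measurableI => //; exact: open_measurable.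
have <- := cvg_lim (@ereal_hausdorff _) cvg.
apply: lime_le; first by apply/cvg_ex; exists (nu (\bigcup_n V n)).
apply: nearW => n /=.
have tA : trivIset setT (A n).
  apply/trivIsetP => i j _ _.
  wlog ij : i j / (i < j)%N.
    move=> K; rewrite neq_ltn => /orP[|] ij; [|rewrite setIC]; apply: K => //;
    by rewrite neq_ltn ij ?orbT.
  move=> _; apply/seteqP; split => // z []; rewrite /A; case: asboolP => // _ + .
  case: asboolP => // _; rewrite /cell /= !in_itv /= => /andP[_ z1] /andP[z2 _].
  by have := le_lt_trans (le_trans z1 (pt_le n ij)) z2; rewrite ltxx.
rewrite /V measure_bigsetU//; last by move=> i; exact: mA.
pose x (i : 'I_(2 ^ n)) : R := pt n i.
pose y (i : 'I_(2 ^ n)) : R := if `[< cell n i `<=` U >] then pt n i.+1 else pt n i.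
have xy i : [/\ a <= x i, x i <= y i & y i <= b].
  split; first by rewrite /x -(pt0 n); exact: pt_le.
    by rewrite /x /y; case: ifP => // _; exact: pt_le.
  by rewrite /y -(pt_last n); case: ifP => _; apply: pt_le => //; exact: ltnW.
have Axy (i : 'I_(2 ^ n)) : A n i = `]x i, y i]%classic.
  by rewrite /A /x /y; case: ifP => // _; rewrite set_itvoc0.
have -> : (\sum_(i < 2 ^ n) nu (A n i) = (\sum_(i < 2 ^ n) `|F (y i) - F (x i)|)%:E)%E.
  rewrite -sumEFin; apply: eq_bigr => i _; have [ax xyi yb] := xy i.
  rewrite Axy nuE// ger0_norm// subr_ge0; exact: ndF.
rewrite lee_fin; apply/ltW/H => //.
  apply/trivIsetP => i j _ _ ij.
  have /trivIsetP/(_ i j I I ij) := tA; rewrite !Axy => /seteqP[h _].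
  apply/seteqP; split => // z [zi zj]; apply: (h z); split.
    exact: subset_itv_oo_oc zi.
  exact: subset_itv_oo_oc zj.
rewrite -lte_fin; apply: le_lt_trans Ud.
have muA (i : 'I_(2 ^ n)) : mu (A n i) = (y i - x i)%:E.
  rewrite Axy lebesgue_measure_itv /= lte_fin; have [_ + _] := xy i.
  by rewrite le_eqVlt => /orP[/eqP ->|->]; rewrite ?ltxx ?subrr// EFinB.
have -> : ((\sum_(i < 2 ^ n) (y i - x i))%:E = mu (V n))%E.
  rewrite -sumEFin /V measure_bigsetU//; last by move=> i; exact: mA.
  by apply: eq_bigr => i _; exact/esym/muA.
apply: le_measure; rewrite ?inE; [exact: mV|exact: open_measurable|].
by move=> z /VP[i [_ cz]]; apply.
Qed.

End open_small.

Let nu_mu : nu `<< mu.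
Proof.
apply/null_content_dominatesP => N mN N0.
apply/eqP; rewrite eq_le measure_ge0 andbT; apply/lee_addgt0Pr => e e0.
rewrite add0e; have [d d0 H] := acF e0.
have [|U [oU NU UN]] := @lebesgue_regularity_outer R N d mN _ d0.
  by rewrite N0.
apply: (@le_trans _ _ (nu U)).
  by apply: le_measure; rewrite ?inE//; exact: open_measurable.
apply: (nu_open_le oU H).
have mU := open_measurable oU.
rewrite -(setDKU NU) (le_lt_trans (measureU2 _ _ _))//.
  exact: measurableD.
by rewrite N0 adde0.
Qed.

(** The Lebesgue-Stieltjes measure nu of F, restricted to ]a, b], vanishes on null
    sets, since a null set is contained in open sets of arbitrarily small length. Its
    Radon-Nikodym density f then represents the increments of F, and the Lebesgue
    differentiation theorem identifies f with the derivative of F. *)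
Lemma monotone_abs_cont_density : exists f : R -> R,
  [/\ mu.-integrable setT (EFin \o f),
    forall x y, a <= x -> x <= y -> y <= b ->
      (F y - F x)%:E = (\int[mu]_(t in `]x, y]) (f t)%:E)%E &
    {ae mu, forall x, a < x < b -> is_derive x 1 F (f x)}].
Proof.
have [g [g0 gfin ig gE]] := radon_nikodym_sigma_finite nu_mu.
have gf : g = EFin \o (fine \o g) by apply/funext => x /=; rewrite fineK.
pose f := fine \o g; rewrite gf -/f in ig gE.
have fE x y : a <= x -> x <= y -> y <= b ->
    (F y - F x)%:E = (\int[mu]_(t in `]x, y]) (f t)%:E)%E.
  by move=> ax xy yb; rewrite -gE// nuE.
exists f; split => //.
have := @FTC1 R f (BRight a).
have /[swap] /[apply] : forall y, mu.-integrable [set` Interval (BRight a) (BRight y)] (EFin \o f).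
  by move=> y; apply: integrableS ig.
have /[swap] /[apply] : locally_integrable [set: R] f.
  by apply: open_integrable_locally => //; exact: openT.
apply: filterS; first exact: (ae_filter_ringOfSetsType mu).
move=> x /= h /andP[ax xb].
have [] := h; first by rewrite lte_fin.
set H := (X in derivable X) => dH H'.
have e : {near x, (fun y => H y + F a) =1 F}.
  near=> y; have ay : a <= y by apply: ltW; near: y; exact: lt_nbhsr.
  have yb : y <= b by apply: ltW; near: y; exact: lt_nbhsl.
  by rewrite /H /Rintegral -fE//= subrK.
apply: near_eq_is_derive e _.
rewrite -[f x]addr0 -H' derive1E.
by apply: is_deriveD; exact/derivableP.
Unshelve. all: by end_near. Qed.

End density.
End monotone_absolutely_continuous.

(** * The fundamental theorem of calculus for absolutely continuous functions *)

Section fundamental_theorem.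
Context {R : realType}.
Notation mu := (@lebesgue_measure R).

(** By difference from the monotone case, applied to the variation T of u and to
    T - u. *)
Lemma abs_cont_density (a b : R) (u : R -> R) : a < b -> abs_cont a b u ->
  exists f : R -> R,
  [/\ mu.-integrable setT (EFin \o f),
    forall x y, a <= x -> x <= y -> y <= b -> u y - u x = \int[mu]_(t in `]x, y]) f t &
    {ae mu, forall x, a < x < b -> is_derive x 1 u (f x)}].
Proof.
move=> ab acu; have bv := abs_cont_bounded_variation (ltW ab) acu.
have acT := abs_cont_total_variation (ltW ab) acu.
pose T x := fine (total_variation a x u).
have [f1 [if1 f1E df1]] := monotone_abs_cont_density ab acT
  (fun x y ax xy yb => total_variation_fine_nondecreasing ax xy yb bv).
have [f2 [if2 f2E df2]] := monotone_abs_cont_density ab (abs_contB acT acu)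
  (fun x y ax xy yb => total_variation_sub_nondecreasing ax xy yb bv).
exists (fun x => f1 x - f2 x); split.
- by have := integrableB measurableT if1 if2; apply: eq_integrable.
- move=> x y ax xy yb; rewrite RintegralB//; last 2 first.
    by apply: integrableS if1.
    by apply: integrableS if2.
  rewrite /Rintegral -f1E// -f2E//=; ring.
- have Fae := ae_filter_ringOfSetsType mu.
  apply: filterS2 df1 df2 => x /= d1 d2 xab.
  rewrite (_ : u = T \- (T \- u)); last first.
    by apply/funext => y /=; ring.
  by apply: is_deriveB; [exact: d1|exact: d2].
Qed.

(** On the null set where u is not differentiable its derivative takes a junk value,
    which the integral ignores. Measurability of that extended derivative is assumed
    because it is part of the definition of the weighted spaces. *)
Lemma loc_abs_cont_FTC (u : R -> R) (x y : R) : loc_abs_cont u ->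
  measurable_fun (`]0, +oo[ : set R) u^`() -> 0 < x -> x <= y ->
  mu.-integrable `]x, y] (EFin \o u^`()) /\
  u y - u x = \int[mu]_(t in `]x, y]) (u^`())%classic t.
Proof.
move=> acu mu' x0 xy.
have ab : x / 2 < y + 1 by lra.
have a0 : 0 < x / 2 by lra.
have [f [fi fE df]] := abs_cont_density ab (acu _ _ a0 (ltW ab)).
have mxy : measurable (`]x, y] : set R) by exact: measurable_itv.
have mu'xy : measurable_fun (`]x, y] : set R) u^`().
  apply: measurable_funS mu' => //.
  by move=> t /=; rewrite !in_itv /= => /andP[? _]; rewrite andbT; lra.
have ifxy : mu.-integrable `]x, y] (EFin \o f) by apply: integrableS fi.
have ae : ae_eq mu `]x, y] (EFin \o f) (EFin \o u^`()).
  have Fae := ae_filter_ringOfSetsType mu.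
  apply: filterS df => t /= dt; rewrite in_itv /= => /andP[xt ty].
  by rewrite derive1E; have /@derive_val -> : is_derive t 1 u (f t) by apply: dt; lra.
split.
  apply/integrableP; split; first exact/measurable_EFinP.
  have /integrableP[_] := ifxy.
  congr (_ < _)%E; apply: ae_eq_integral => //.
  - by apply/measurableT_comp => //; exact: (measurable_int _ ifxy).
  - by apply/measurableT_comp => //; exact/measurable_EFinP.
  - have Fae := ae_filter_ringOfSetsType mu.
    by apply: filterS ae => t h tD; exact: (f_equal abse (h tD)).
rewrite fE//; [|lra|lra]; congr fine; apply: ae_eq_integral => //.
- exact: (measurable_int _ ifxy).
- exact/measurable_EFinP.
Qed.

End fundamental_theorem.

(** * Smooth functions and bumps *)

Section smooth_functions.
Context {R : realType}.
Implicit Types (f g : R -> R) (k : R) (P : {poly R}).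

(** Differentiability n + 1 times, by recursion on the derivative rather than
    through the iterate f^`(n): closure under sums and products then follows
    by induction, without the Leibniz formula. *)
Fixpoint Cn n f : Prop :=
  (forall t, derivable f t 1) /\
  if n is m.+1 then Cn m f^`() else True.

Definition smooth f := forall n, Cn n f.

Lemma smooth_derivable f : smooth f -> forall n t, derivable f^`(n) t 1.
Proof.
move=> + n; elim: n f => [|n ih] f sf t; first exact: (sf 0%N).1.
rewrite derive1Sn; apply: ih => m; exact: (sf m.+1).2.
Qed.

Lemma smooth_continuous f : smooth f -> continuous f.
Proof.
move=> sf t; apply: differentiable_continuous; apply/derivable1_diffP.
exact: (sf 0%N).1.
Qed.

Lemma smooth_measurable D f : smooth f -> measurable_fun D f.
Proof.
move=> sf; apply: (@measurable_funS _ _ _ _ setT) => //.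
by apply: continuous_measurable_fun; exact: smooth_continuous.
Qed.

Lemma Cn_is_derive n f f' : (forall t : R, is_derive t (1 : R) f (f' t)) ->
  (if n is m.+1 then Cn m f' else True) -> Cn n f.
Proof.
move=> df; have -> : f' = f^`().
  by apply/funext => t; rewrite derive1E; have [_ ->] := df t.
by case: n => [|n] ?; split => // t; have [] := df t.
Qed.

Lemma CnW n f : Cn n.+1 f -> Cn n f.
Proof. by elim: n f => [|n ih] f [df cf]; split => //; exact: ih. Qed.

Lemma Cn_cst n (c : R) : Cn n (fun=> c).
Proof.
elim: n c => [|n ih] c; apply: (@Cn_is_derive _ _ (fun=> 0)) => // t;
  exact: is_derive_cst.
Qed.

Lemma Cn_add n f g : Cn n f -> Cn n g -> Cn n (fun t => f t + g t).
Proof.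
elim: n f g => [|n ih] f g [df cf] [dg cg];
  apply: (@Cn_is_derive _ _ (fun t => derive1 f t + derive1 g t)) => //.
1,2: by move=> t; rewrite !derive1E; apply: is_deriveD; exact/derivableP.
exact: ih.
Qed.

Lemma Cn_mul n f g : Cn n f -> Cn n g -> Cn n (fun t => f t * g t).
Proof.
have dM f1 g1 (t : R) : derivable f1 t 1 -> derivable g1 t 1 ->
    is_derive t (1 : R) (fun t => f1 t * g1 t) (derive1 f1 t * g1 t + f1 t * derive1 g1 t).
  move=> df dg; rewrite addrC [derive1 f1 t * g1 t]mulrC !derive1E.
  by apply: is_deriveM; exact/derivableP.
elim: n f g => [|n ih] f g Cf Cg.
  by apply: (Cn_is_derive (fun t => dM f g t (Cf.1 t) (Cg.1 t))).
apply: (Cn_is_derive (fun t => dM f g t (Cf.1 t) (Cg.1 t))).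
by apply: Cn_add; apply: ih; [exact: Cf.2|exact: CnW|exact: CnW|exact: Cg.2].
Qed.

Lemma Cn_affine n f (c d : R) : Cn n f -> Cn n (fun t => f (c * t + d)).
Proof.
have dA f1 (t : R) : derivable f1 (c * t + d) 1 ->
    is_derive t (1 : R) (fun t => f1 (c * t + d)) (derive1 f1 (c * t + d) * c).
  move=> df; have -> : (fun t => f1 (c * t + d)) = f1 \o (fun t => c * t + d) by [].
  apply: is_derive1_comp; first by rewrite derive1E; exact/derivableP.
  by apply: is_derive_eq; rewrite ?addr0 [_ *: 1]mulr1.
elim: n f => [|n ih] f Cf; first by apply: (Cn_is_derive (fun t => dA f t (Cf.1 _))).
apply: (Cn_is_derive (fun t => dA f t (Cf.1 _))).
by apply: Cn_mul; [exact: ih Cf.2|exact: Cn_cst].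
Qed.

(** For P = 1 this is exp(- k / x) extended by 0 to x <= 0, the standard smooth
    function that is not analytic. The polynomial factor in 1 / x makes the family
    stable under differentiation, which is all that its smoothness requires. *)
Definition flat_exp k P (x : R) : R :=
  if 0 < x then P.[x^-1] * expR (- (k / x)) else 0.

(** Induction on P: each factor y is absorbed by half of the exponential decay, by
    y * (k / 2) <= exp(y * (k / 2)). *)
Lemma polyexp_bounded P k : 0 < k -> exists2 C, 0 <= C &
  forall y, 0 < y -> `|P.[y] * expR (- (k * y))| <= C.
Proof.
elim/poly_ind: P k => [|P c ih] k k0.
  by exists 0 => // y _; rewrite horner0 mul0r normr0.
have k20 : 0 < k / 2 by lra.
have [C C0 HC] := ih _ k20.
exists (C * (2 / k) + `|c|) => [|y y0].
  by rewrite addr_ge0// mulr_ge0// divr_ge0// ltW.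
have -> : (P * 'X + c%:P).[y] * expR (- (k * y)) =
   P.[y] * expR (- (k / 2 * y)) * (y * expR (- (k / 2 * y))) + c * expR (- (k * y)).
  rewrite !hornerE /=; have -> : - (k * y) = - (k / 2 * y) + - (k / 2 * y) by lra.
  by rewrite expRD; move: (expR _) => E; ring.
rewrite (le_trans (ler_normD _ _))// lerD//.
  rewrite normrM ler_pM//; first exact: HC.
  rewrite ger0_norm ?mulr_ge0 ?expR_ge0 ?(ltW y0)// expRN.
  rewrite ler_pdivrMr ?expR_gt0// mulrC -ler_pdivrMr ?divr_gt0//.
  have := expR_ge1Dx (k / 2 * y); rewrite invf_div; lra.
rewrite normrM ler_piMr// ger0_norm ?expR_ge0// -expR0 ler_expR oppr_le0.
by rewrite mulr_ge0// ltW.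
Qed.

Lemma flat_exp_bounded k P : 0 < k -> exists2 C, 0 <= C & forall x, `|flat_exp k P x| <= C.
Proof.
move=> k0; have [C C0 HC] := polyexp_bounded P k0; exists C => // x.
rewrite /flat_exp; case: ifP => x0; last by rewrite normr0.
by apply: HC; rewrite invr_gt0.
Qed.

Lemma flat_exp0 k P : flat_exp k P 0 = 0.
Proof. by rewrite /flat_exp ltxx. Qed.

(** A factor x can always be extracted, so flat_exp k P is o(1) and even O(x) at 0;
    this gives both continuity and differentiability there. *)
Lemma flat_expMX k P x : flat_exp k P x = flat_exp k (P * 'X) x * x.
Proof.
rewrite /flat_exp; case: ifP => x0; last by rewrite mul0r.
rewrite !hornerE mulrAC -[_ * x^-1 * x]mulrA mulVf ?mulr1//.
by rewrite gt_eqF.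
Qed.

Lemma flat_exp_cvg0 k P : 0 < k -> flat_exp k P x @[x --> 0] --> 0.
Proof.
move=> k0; have [C C0 HC] := flat_exp_bounded (P * 'X) k0.
apply/cvgrPdist_lt => e e0; near=> x.
rewrite sub0r normrN flat_expMX normrM.
apply: (@le_lt_trans _ _ (C * `|x|)); first by rewrite ler_wpM2r.
apply: (@le_lt_trans _ _ ((C + 1) * `|x|)); first by rewrite ler_wpM2r// lerDl.
rewrite mulrC -ltr_pdivlMr; last by lra.
near: x; apply/nbhs_ballP; exists (e / (C + 1)); first by rewrite /= divr_gt0//; lra.
by move=> x; rewrite /ball/= sub0r normrN.
Unshelve. all: by end_near. Qed.

Lemma is_derive_flat_exp k P x : 0 < k ->
  is_derive x (1 : R) (flat_exp k P) (flat_exp k ('X^2 * (k *: P - P^`())) x).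
Proof.
move=> k0; have [x0|x0|->] := ltgtP x 0.
- rewrite {2}/flat_exp ltNge (ltW x0)/=.
  apply: (@near_eq_is_derive _ _ _ (fun=> 0)).
  near=> y; rewrite /flat_exp ltNge (_ : y <= 0)//=.
  by apply: ltW; near: y; exact: lt_nbhsl.
- rewrite {2}/flat_exp x0.
  have e : {near x, (fun y => P.[y^-1] * expR (- (k / y))) =1 flat_exp k P}.
    near=> y; rewrite /flat_exp (_ : 0 < y)//=.
    by near: y; exact: lt_nbhsr.
  apply: near_eq_is_derive e _.
  have xN : x != 0 by rewrite gt_eqF.
  have dV : is_derive x (1 : R) (fun y : R => y^-1) (- x ^- 2).
    have := @is_deriveV R id x 1 1 xN (is_derive_id _ _).
    by rewrite [_ *: _]mulr1.
  have dP : is_derive x (1 : R) (fun y => P.[y^-1]) (P^`().[x^-1] * (- x ^- 2)).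
    have -> : (fun y => P.[y^-1]) = (horner P) \o (fun y => y^-1) by [].
    by apply: is_derive1_comp.
  have dE : is_derive x (1 : R) (fun y => expR (- (k / y))) (expR (- (k / x)) * (k * x ^- 2)).
    have -> : (fun y => expR (- (k / y))) = expR \o (fun y => - (k / y)) by [].
    apply: is_derive1_comp.
    apply: is_derive_eq; rewrite scalerN opprK //.
  apply: is_derive_eq.
  rewrite /= !hornerE /= /GRing.scale /= -exprVn.
  set E := expR _; set X := x^-1. ring.
- rewrite flat_exp0.
  apply/is_derive1_caratheodory; exists (flat_exp k (P * 'X)); split.
  + by move=> z; rewrite flat_exp0 !subr0 flat_expMX.
  + rewrite /prop_for /continuous_at flat_exp0; exact: flat_exp_cvg0.
  + exact: flat_exp0.
Unshelve. all: by end_near. Qed.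

Lemma smooth_flat_exp k P : 0 < k -> smooth (flat_exp k P).
Proof.
move=> k0 n; elim: n P => [|n ih] P;
  apply: (Cn_is_derive (fun t => is_derive_flat_exp P t k0)) => //.
Qed.

(** A smooth function supported in ]a, b[, with values in [0, 1], that tends to the
    indicator of ]a, b[ as k tends to 0. *)
Definition bump (a b k t : R) : R := flat_exp k 1 (t - a) * flat_exp k 1 (b - t).

Lemma smooth_bump a b k : 0 < k -> smooth (bump a b k).
Proof.
move=> k0 n; apply: Cn_mul.
- have -> : (fun t => flat_exp k 1 (t - a)) = (fun t => flat_exp k 1 (1 * t + - a)).
    by apply/funext => t; rewrite mul1r.
  by apply: Cn_affine; exact: smooth_flat_exp.
- have -> : (fun t => flat_exp k 1 (b - t)) = (fun t => flat_exp k 1 (-1 * t + b)).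
    by apply/funext => t; rewrite mulN1r addrC.
  by apply: Cn_affine; exact: smooth_flat_exp.
Qed.

Lemma flat_exp1_01 k x : 0 < k -> 0 <= flat_exp k 1 x <= 1.
Proof.
move=> k0; rewrite /flat_exp; case: ifP => x0; last by rewrite lexx ler01.
rewrite hornerC mul1r expR_ge0/= -expR0 ler_expR oppr_le0.
by rewrite divr_ge0// ltW.
Qed.

Lemma bump_01 a b k t : 0 < k -> 0 <= bump a b k t <= 1.
Proof.
move=> k0; have /andP[h1 h2] := flat_exp1_01 (t - a) k0.
have /andP[h3 h4] := flat_exp1_01 (b - t) k0.
by rewrite /bump mulr_ge0//= mulr_ile1.
Qed.

Lemma bump_out a b k t : ~ (a < t < b) -> bump a b k t = 0.
Proof.
move=> /negP; rewrite negb_and -!leNgt /bump /flat_exp => /orP[h|h].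
  by rewrite subr_gt0 ltNge h mul0r.
by rewrite [0 < b - t]subr_gt0 [t < b]ltNge h mulr0.
Qed.

Lemma bump_cvg a b t : a < t < b -> bump a b n.+1%:R^-1 t @[n --> \oo] --> (1 : R).
Proof.
move=> /andP[h1 h2].
have H x : 0 < x -> flat_exp n.+1%:R^-1 1 x @[n --> \oo] --> (1 : R).
  move=> x0; rewrite /flat_exp x0.
  under eq_fun do rewrite hornerC mul1r.
  have -> : nbhs (1 : R) = nbhs (expR (- (0 * x^-1))) by rewrite mul0r oppr0 expR0.
  apply: continuous_cvg; first exact: continuous_expR.
  by apply: cvgN; apply: cvgM; [exact: cvg_harmonic|exact: cvg_cst].
have -> : nbhs (1 : R) = nbhs (1 * 1 : R) by rewrite mulr1.
by apply: cvgM; apply: H; rewrite subr_gt0.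
Qed.

End smooth_functions.

(** * Smooth approximation of bounded functions in mean *)

Lemma near_cvge0_le {R : realType} (f : nat -> \bar R) (e : R) : 0 < e ->
  f @ \oo --> 0%E -> \forall n \near \oo, (f n <= e%:E)%E.
Proof.
move=> e0 /fine_cvgP[fin /cvgrPdist_lt/(_ _ e0) lt].
apply: filterS2 fin lt => n nfin nlt.
rewrite -[leLHS]fineK// lee_fin (le_trans (ler_norm _))// ltW//.
by rewrite -normrN -sub0r.
Qed.

Lemma normr_Rintegral_le {R : realType} (D : set R) (f : R -> R) (e : R) :
  measurable D -> lebesgue_measure.-integrable D (EFin \o f) ->
  (\int[lebesgue_measure]_(t in D) (`|f t|)%:E <= e%:E)%E ->
  `|\int[lebesgue_measure]_(t in D) f t| <= e.
Proof.
move=> mD intf fe.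
apply: le_trans (@le_normr_Rintegral _ _ _ lebesgue_measure D f mD intf) _.
rewrite -lee_fin fineK// ge0_fin_numE; last first.
  by apply: integral_ge0 => t _; rewrite lee_fin.
by apply: le_lt_trans fe _; rewrite ltry.
Qed.

Section smooth_approximation.
Context {R : realType}.
Notation mu := (@lebesgue_measure R).
Implicit Types (a b c d x y t e M : R) (f g h s : R -> R).

Lemma clamp_dist a b x y : a <= b -> `|clamp a b x - clamp a b y| <= `|x - y|.
Proof.
move=> ab; wlog xy : x y / y <= x.
  move=> H; have [/H//|/ltW yx] := leP y x.
  by rewrite distrC [leRHS]distrC; exact: H.
rewrite !ger0_norm ?subr_ge0//; first exact: clamp_lip.
exact: clamp_le.
Qed.

(** Compactness of [a, b] in its near-covering form, with the radius d as parameter. *)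
Lemma uniform_continuity a b h : continuous h -> forall e, 0 < e ->
  exists2 d, 0 < d & forall x y, a <= x -> x <= b -> `|x - y| < d -> `|h x - h y| < e.
Proof.
move=> ch e e0.
have /compact_near_coveringP K : compact (`[a, b] : set R) by exact: segment_compact.
have := K _ ((0 : R)^'+)
  (fun d x => forall y, `|x - y| < d -> `|h x - h y| < e) _.
case=> [x _|d /= d0 H].
  have e20 : 0 < e / 2 by lra.
  have /cvgrPdist_lt/(_ _ e20)/nbhs_ballP[r /= r0 hr] := ch x.
  near=> x' d => /= y x'y.
  have xx' : `|x - x'| < r / 2.
    by near: x'; apply/nbhs_ballP; exists (r / 2) => //=; lra.
  have dr : d < r / 2 by near: d; apply: nbhs_right_lt; lra.
  rewrite (_ : h x' - h y = (h x - h y) - (h x - h x')); last by ring.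
  rewrite (le_lt_trans (ler_normB _ _))// [e]splitr ltrD//.
    apply: hr; rewrite /ball /= (_ : x - y = (x - x') + (x' - y)); last by ring.
    by rewrite (le_lt_trans (ler_normD _ _))//; lra.
  by apply: hr; rewrite /ball /=; lra.
exists (d / 2) => [|x y ax xb xy]; first by move: d0 => /=; lra.
have d2 : 0 < d / 2 by lra.
apply: (H (d / 2)) => //=; last by rewrite in_itv /= ax.
by rewrite sub0r normrN gtr0_norm//; lra.
Unshelve. all: by end_near. Qed.

Lemma integral_cst_itvoc a b (r : R) : a <= b ->
  (\int[mu]_(t in `]a, b]) r%:E = (r * (b - a))%:E)%E.
Proof.
move=> ab; rewrite integral_cst; last exact: measurable_itv.
suff H : mu `]a, b]%classic = (b - a)%:E by rewrite EFinM -H.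
rewrite lebesgue_measure_itv /= lte_fin.
by move: ab; rewrite le_eqVlt => /orP[/eqP ->|->]; rewrite ?ltxx ?subrr// EFinB.
Qed.

(** Dominated convergence along k = 1 / (n + 1). *)
Lemma bump_L1 a b e : a <= b -> 0 < e -> exists2 k, 0 < k &
  (\int[mu]_(t in `]a, b]) (`|1 - bump a b k t|)%:E <= e%:E)%E.
Proof.
move=> ab e0.
have mb k : 0 < k -> measurable_fun (setT : set R) (fun t => `|1 - bump a b k t|).
  move=> k0; apply: measurableT_comp => //; apply: measurable_funB => //.
  by apply: smooth_measurable; exact: smooth_bump.
have k0 n : (0 : R) < n.+1%:R^-1 by [].
have mo : measurable (`]a, b[ : set R) by exact: measurable_itv.
have multy : (mu `]a, b[%classic < +oo)%E.
  by rewrite lebesgue_measure_itv /=; case: ifP => _; rewrite -?EFinB ltry.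
have H : (\int[mu]_(t in `]a, b[) (`|1 - bump a b n.+1%:R^-1 t|)%:E)%E
    @[n --> \oo] --> (\int[mu]_(t in `]a, b[) (cst 0 t))%E.
  apply: (@dominated_cvg _ _ _ mu _ mo _ _ (cst 1%E)).
  - move=> n; apply/measurable_EFinP.
    by apply: measurable_funS (mb _ (k0 n)).
  - move=> t /=; rewrite in_itv /= => tab.
    suff : (`|1 - bump a b n.+1%:R^-1 t|)%:E @[n --> \oo] --> (`|1 - 1 : R|)%:E.
      by rewrite subrr normr0.
    apply: cvg_EFin; first by near=> n.
    by apply: cvg_norm; apply: cvgB; [exact: cvg_cst|exact: bump_cvg].
  - by [].
  - apply/integrableP; split => //.
    under eq_integral do rewrite /= normr1.
    rewrite integral_cst// mul1e; exact: multy.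
  - move=> n t _ /=; rewrite lee_fin normr_id ler_norml.
    have /andP[h1 h2] := bump_01 a b t (k0 n); apply/andP; split; lra.
rewrite integral0 in H.
have [n _ /(_ n (leqnn n)) /= le] := near_cvge0_le e0 H.
exists n.+1%:R^-1 => //.
rewrite -integral_itv_bndo_bndc//.
by apply/measurable_EFinP; apply: measurable_funS (mb _ (k0 n)).
Unshelve. all: by end_near. Qed.

(** The sup bound M is carried along because it is what later converts
    L1-smallness into smallness of integrals of p-th powers. *)
Definition smooth_in a b M s :=
  [/\ smooth s, forall t, ~ (a < t < b) -> s t = 0 & forall t, `|s t| <= M].

Lemma smooth_in_measurable a b M s : smooth_in a b M s -> measurable_fun setT s.
Proof. by case=> ss _ _; apply: continuous_measurable_fun; exact: smooth_continuous. Qed.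

Lemma smooth_approx_cst x y (c : R) M h r : x <= y -> `|c| <= M -> 0 < r ->
  continuous h -> (forall t, x < t -> t <= y -> `|h t - c| <= r) ->
  exists2 s, smooth_in x y M s &
    (\int[mu]_(t in `]x, y]) (`|h t - s t|)%:E <= ((r + r) * (y - x))%:E)%E.
Proof.
rewrite le_eqVlt => /orP[/eqP <-|xy] cM r0 ch hc.
  exists (fun=> 0).
    split => [n|//|t]; first exact: Cn_cst.
    by rewrite normr0 (le_trans _ cM).
  by rewrite set_itvoc0 integral_set0 subrr mulr0.
have M0 : 0 <= M by rewrite (le_trans _ cM).
have e0 : 0 < r * (y - x) / (M + 1).
  by rewrite divr_gt0 ?mulr_gt0//; lra.
have [k k0 Hk] := bump_L1 (ltW xy) e0.
exists (fun t => c * bump x y k t).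
  split.
  - by move=> n; apply: Cn_mul; [exact: Cn_cst|exact: smooth_bump].
  - by move=> t tn; rewrite bump_out// mulr0.
  - move=> t; have /andP[h1 h2] := bump_01 x y t k0.
    by rewrite normrM (ger0_norm h1) (le_trans _ cM)// ler_piMr.
have mh : measurable_fun (`]x, y] : set R) h.
  apply: measurable_funS (continuous_measurable_fun ch) => //.
have mb : measurable_fun (`]x, y] : set R) (bump x y k).
  by apply: smooth_measurable; exact: smooth_bump.
apply: (@le_trans _ _ (\int[mu]_(t in `]x, y]) (r%:E + M%:E * (`|1 - bump x y k t|)%:E))%E).
  apply: ge0_le_integral => //.
  - apply/measurable_EFinP; apply: measurableT_comp => //.
    by apply: measurable_funB => //; exact: measurable_funM.
  - apply/measurable_EFinP; apply: measurable_funD => //.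
    apply: measurable_funM => //; apply: measurableT_comp => //.
    exact: measurable_funB.
  - move=> t /=; rewrite in_itv /= => /andP[xt ty].
    rewrite -EFinM -EFinD lee_fin.
    rewrite (_ : h t - _ = (h t - c) + c * (1 - bump x y k t)); last by ring.
    rewrite (le_trans (ler_normD _ _))// lerD ?hc//.
    by rewrite normrM ler_wpM2r.
rewrite ge0_integralD//=; last 3 first.
- by move=> t _; rewrite lee_fin ltW.
- by move=> t _; rewrite -EFinM lee_fin mulr_ge0.
- apply/measurable_EFinP; apply: measurable_funM => //; apply: measurableT_comp => //.
  exact: measurable_funB.
rewrite integral_cst_itvoc; last exact: ltW.
rewrite ge0_integralZl//=; last first.
  by apply/measurable_EFinP; apply: measurableT_comp => //; exact: measurable_funB.
rewrite mulrDl EFinD; apply: leeD => //.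
apply: (@le_trans _ _ (M%:E * (r * (y - x) / (M + 1))%:E)%E).
  by apply: lee_wpmul2l.
rewrite -EFinM lee_fin mulrA ler_pdivrMr; last lra.
rewrite mulrC ler_wpM2l//; last lra.
by rewrite mulr_ge0//; lra.
Qed.

(** At each point one of the two summands vanishes, so the bound M does not double. *)
Lemma smooth_in_glue a x y M s1 s2 h r1 r2 : a <= x -> x <= y -> continuous h ->
  smooth_in a x M s1 -> smooth_in x y M s2 ->
  (\int[mu]_(t in `]a, x]) (`|h t - s1 t|)%:E <= r1%:E)%E ->
  (\int[mu]_(t in `]x, y]) (`|h t - s2 t|)%:E <= r2%:E)%E ->
  let s t := s1 t + s2 t in
  smooth_in a y M s /\
  (\int[mu]_(t in `]a, y]) (`|h t - s t|)%:E <= (r1 + r2)%:E)%E.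
Proof.
move=> ax xy ch /[dup] S1 [ss1 z1 M1] /[dup] S2 [ss2 z2 M2] H1 H2 s; split.
  split.
  - by move=> n; exact: Cn_add.
  - move=> t nt; rewrite /s z1 ?z2 ?addr0// => /andP[? ?]; apply: nt; apply/andP; split; lra.
  - move=> t; rewrite /s; have [tx|xt] := leP t x.
      by rewrite z2 ?addr0// => /andP[]; lra.
    by rewrite z1 ?add0r// => /andP[]; lra.
rewrite (_ : `]a, y]%classic = `]a, x]%classic `|` `]x, y]%classic); last first.
  by rewrite -itv_bndbnd_setU// bnd_simp.
have mh D : measurable D -> measurable_fun D h.
  by move=> mD; apply: measurable_funS (continuous_measurable_fun ch).
have ms1 D : measurable D -> measurable_fun D s1.
  by move=> mD; apply: measurable_funS (smooth_in_measurable S1).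
have ms2 D : measurable D -> measurable_fun D s2.
  by move=> mD; apply: measurable_funS (smooth_in_measurable S2).
have mU : measurable (`]a, x]%classic `|` `]x, y]%classic : set R) by exact: measurableU.
rewrite ge0_integral_setU//=; last 2 first.
- apply/measurable_EFinP; apply: measurableT_comp => //.
  by apply: measurable_funB; [exact: mh|apply: measurable_funD; [exact: ms1|exact: ms2]].
- apply/disj_setPS => t [] /=; rewrite !in_itv /= => /andP[? ?] /andP[? ?]; lra.
rewrite EFinD; apply: leeD.
  apply: le_trans H1; rewrite le_eqVlt; apply/orP; left; apply/eqP; apply: eq_integral => t.
  rewrite inE /= in_itv /= => /andP[? ?]; rewrite /s z2 ?addr0// => /andP[]; lra.
apply: le_trans H2; rewrite le_eqVlt; apply/orP; left; apply/eqP; apply: eq_integral => t.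
rewrite inE /= in_itv /= => /andP[? ?]; rewrite /s z1 ?add0r// => /andP[]; lra.
Qed.

(** A continuous function is nearly constant on the cells of a fine partition, and
    the constants are replaced by multiples of bumps. *)
Lemma smooth_approx_continuous a b M h e : a < b -> 0 < e -> continuous h ->
  (forall t, `|h t| <= M) ->
  exists2 s, smooth_in a b M s & (\int[mu]_(t in `]a, b]) (`|h t - s t|)%:E <= e%:E)%E.
Proof.
move=> ab e0 ch hM.
(* each cell contributes at most 2 r times its length *)
pose r := e / ((b - a) + (b - a)).
have r0 : 0 < r by rewrite divr_gt0//; lra.
have [d d0 Hd] := uniform_continuity a b ch r0.
have [n [pt [pt0 ptn ptle ptd ptab]]] := fine_partition (ltW ab) d0.
suff : forall i, (i <= n)%N -> exists2 s, smooth_in a (pt i) M s &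
    (\int[mu]_(t in `]a, (pt i)]) (`|h t - s t|)%:E <= ((r + r) * (pt i - a))%:E)%E.
  move=> /(_ _ (leqnn _)); rewrite ptn => -[s ss sle]; exists s => //.
  apply: le_trans sle _; rewrite lee_fin /r -mulrDl -mulrA.
  have -> : (b - a + (b - a))^-1 * (b - a) = 2^-1.
    have -> : b - a + (b - a) = 2 * (b - a) by ring.
    by rewrite invfM -mulrA mulVf ?mulr1// subr_eq0 gt_eqF.
  lra.
elim=> [_|i ih ile].
  exists (fun=> 0).
    split => [k|//|t]; first exact: Cn_cst.
    by rewrite normr0 (le_trans _ (hM t)).
  by rewrite pt0 set_itvoc0 integral_set0 lee_fin mulr_ge0 ?subr_ge0//; lra.
have /andP[ai ib] := ptab _ (ltnW ile).
have [s1 S1 H1] := ih (ltnW ile).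
have [|s2 S2 H2] := @smooth_approx_cst (pt i) (pt i.+1) (h (pt i)) M h r (ptle i) (hM _) r0 ch.
  move=> t t1 t2; rewrite distrC ltW//; apply: Hd => //.
  rewrite ltr_norml; have := ptd i; move: t1 t2; move: (pt i) (pt i.+1) => y z.
  by move=> t1 t2 yz; apply/andP; split; lra.
have [S H] := smooth_in_glue ai (ptle i) ch S1 S2 H1 H2.
exists (fun t => s1 t + s2 t) => //.
apply: le_trans H _; rewrite lee_fin -mulrDr ler_wpM2l//; first by lra.
by move: (pt i) (pt i.+1) => y z; lra.
Qed.

(** A bounded function is L1-close to a continuous one, which may be truncated at
    height M without increasing its distance to g. *)
Lemma smooth_approx a b M g e : a < b -> 0 < e -> measurable_fun (`]a, b] : set R) g ->
  (forall t, `|g t| <= M) ->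
  exists2 s, smooth_in a b M s & (\int[mu]_(t in `]a, b]) (`|g t - s t|)%:E <= e%:E)%E.
Proof.
move=> ab e0 mg gM.
have M0 : - M <= M by have := le_trans (normr_ge0 _) (gM 0); lra.
have mE : measurable (`]a, b] : set R) by exact: measurable_itv.
have muE : (mu `]a, b]%classic < +oo)%E.
  by rewrite lebesgue_measure_itv /=; case: ifP => _; rewrite -?EFinB ltry.
have ig : mu.-integrable `]a, b] (EFin \o g).
  apply: measurable_bounded_integrable => //.
  exists M; split; first exact: num_real.
  by move=> N MN t _; exact: le_trans (gM t) (ltW MN).
have [k [ck ik kg]] := approximation_continuous_integrable mE muE ig.
have e20 : 0 < e / 2 by lra.
have [n _ /(_ n (leqnn n)) /= Hn] := near_cvge0_le e20 kg.
pose h := clamp (- M) M \o k n.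
have ch : continuous h.
  move=> x; apply/cvgrPdist_lt => r r0.
  have /cvgrPdist_lt/(_ _ r0) := ck n x; apply: filterS => y.
  by apply: le_lt_trans; exact: clamp_dist.
have hM t : `|h t| <= M.
  by have [h1 h2] := clamp_itv (k n t) M0; rewrite ler_norml h1.
have [s ss sh] := smooth_approx_continuous ab e20 ch hM.
exists s => //.
have ms : measurable_fun (`]a, b] : set R) s by apply: measurable_funS (smooth_in_measurable ss).
have mk : measurable_fun (`]a, b] : set R) (k n).
  by apply: measurable_funS (continuous_measurable_fun (ck n)).
have mh : measurable_fun (`]a, b] : set R) h.
  by apply: measurable_funS (continuous_measurable_fun ch).
have m1 : measurable_fun (`]a, b] : set R) (fun t => (`|g t - k n t|)%:E).
  by apply/measurable_EFinP; apply: measurableT_comp => //; exact: measurable_funB.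
have m2 : measurable_fun (`]a, b] : set R) (fun t => (`|h t - s t|)%:E).
  by apply/measurable_EFinP; apply: measurableT_comp => //; exact: measurable_funB.
apply: (@le_trans _ _ (\int[mu]_(t in `]a, b]) ((`|g t - k n t|)%:E + (`|h t - s t|)%:E))%E).
  apply: ge0_le_integral => //.
  - by apply/measurable_EFinP; apply: measurableT_comp => //; exact: measurable_funB.
  - exact: emeasurable_funD.
  - move=> t _; rewrite -EFinD lee_fin.
    rewrite (_ : g t - s t = (g t - h t) + (h t - s t)); last by ring.
    rewrite (le_trans (ler_normD _ _))// lerD2r.
    have -> : g t = clamp (- M) M (g t).
      by rewrite clamp_id//; have := gM t; rewrite ler_norml => /andP[].
    rewrite [in leRHS]clamp_id; last 2 first.
      by have := gM t; rewrite ler_norml => /andP[].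
      by have := gM t; rewrite ler_norml => /andP[].
    exact: clamp_dist.
by rewrite ge0_integralD// [e]splitr EFinD leeD.
Qed.

End smooth_approximation.

(** * The dual weight and the energy *)

Section weights.
Context {R : realType}.
Notation mu := (@lebesgue_measure R).
Notation pos := (`]0, +oo[%classic : set R).
Implicit Types (a b x y t e : R) (f g : R -> R) (D : set R).

(** The function whose integrability near an end of the half-line defines B_p there. *)
Definition dual_weight (p : R) (w : R -> R) (t : R) : R := w t `^ (- (p - 1)^-1).

(** The p-th power of the weighted norm. Being an integral, it is additive over
    domains, which is why the estimates are made on it rather than on wLnorm. *)
Definition energy (p : R) (w : R -> R) (D : set R) (f : R -> R) : \bar R :=
  (\int[mu]_(t in D) (`|f t| `^ p * w t)%:E)%E.

Variables (p : R) (w : R -> R).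
Hypothesis hp : 1 < p.
Hypothesis w_gt0 : forall t : R, 0 < t -> 0 < w t.
Hypothesis w_cont : {within pos, continuous w}.

Let p0 : 0 < p. Proof. exact: lt_trans ltr01 hp. Qed.
Let pN0 : p != 0. Proof. by rewrite gt_eqF. Qed.
Let q0 : 0 < p - 1. Proof. by rewrite subr_gt0. Qed.

Let inpos D t : D `<=` pos -> D t -> 0 < t.
Proof. by move=> /[apply] /=; rewrite in_itv /= andbT. Qed.

Lemma measurable_weight D : measurable D -> D `<=` pos -> measurable_fun D w.
Proof.
move=> mD Dpos; apply: (@measurable_funS _ _ _ _ pos) => //.
exact: subspace_continuous_measurable_fun.
Qed.

Lemma measurable_dual_weight D : measurable D -> D `<=` pos ->
  measurable_fun D (dual_weight p w).
Proof.
move=> mD Dpos.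
by apply: (measurableT_comp (measurable_powR _)); exact: measurable_weight.
Qed.

Lemma measurable_energy D f : measurable D -> D `<=` pos -> measurable_fun D f ->
  measurable_fun D (fun t => (`|f t| `^ p * w t)%:E).
Proof.
move=> mD Dpos mf; apply/measurable_EFinP; apply: measurable_funM.
  by apply: (measurableT_comp (measurable_powR _)); exact: measurableT_comp.
exact: measurable_weight.
Qed.

Lemma energy_ge0 D f : D `<=` pos -> (0 <= energy p w D f)%E.
Proof.
move=> Dpos; apply: integral_ge0 => t /(inpos Dpos) t0.
by rewrite lee_fin mulr_ge0 ?powR_ge0// ltW// w_gt0.
Qed.

Lemma dual_weight_gt0 t : 0 < t -> 0 < dual_weight p w t.
Proof. by move=> t0; rewrite powR_gt0// w_gt0. Qed.

Lemma dual_weight_powR t : 0 < t -> dual_weight p w t `^ (1 - p) = w t.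
Proof.
move=> t0; rewrite -powRrM (_ : _ * _ = 1) ?powRr1 ?(ltW (w_gt0 t0))//.
by rewrite -(opprB p 1) mulrNN mulVf// gt_eqF.
Qed.

(** The dual weight is the extremal function for the passage between energy and
    integral: its energy density coincides with itself. *)
Lemma dual_weight_energy t : 0 < t -> dual_weight p w t `^ p * w t = dual_weight p w t.
Proof.
move=> t0; rewrite -dual_weight_powR// -powRD.
  by rewrite addrCA subrr addr0 powRr1// ltW// dual_weight_gt0.
by rewrite addrCA subrr addr0 oner_eq0.
Qed.

(** This plays the part of Hoelder's inequality. Either x is at most r times the
    dual weight s, or x = x^p * x^(1-p) <= x^p * (r s)^(1-p), and s^(1-p) = w. *)
Lemma le_dual_weight_energy t x r : 0 < t -> 0 <= x -> 0 < r ->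
  x <= r * dual_weight p w t + r `^ (1 - p) * (x `^ p * w t).
Proof.
move=> t0 x0 r0; set s := dual_weight p w t.
have s0 : 0 < s by exact: dual_weight_gt0.
have [xs|sx] := leP x (r * s).
  by rewrite ler_wpDr// !mulr_ge0 ?powR_ge0// ltW// w_gt0.
rewrite ler_wpDl//; first by rewrite mulr_ge0// ltW.
have xp : 0 < x by rewrite (lt_trans _ sx)// mulr_gt0.
rewrite -(dual_weight_powR t0) -/s [x `^ p * _]mulrC mulrA -powRM ?(ltW r0) ?(ltW s0)//.
rewrite -{1}[x](@powRr1 _ _ x0) -{1}(subrK p 1) powRD; last first.
  by rewrite subrK oner_eq0.
rewrite ler_wpM2r ?powR_ge0// -(opprB p 1) !powRN lef_pV2 ?posrE ?powR_gt0 ?mulr_gt0//.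
by apply: ge0_ler_powR; rewrite ?nnegrE ?mulr_ge0 ?(ltW r0) ?(ltW s0) ?(ltW q0) ?ltW.
Qed.

Lemma L1_le_energy D f r : measurable D -> D `<=` pos -> measurable_fun D f -> 0 < r ->
  (\int[mu]_(t in D) (`|f t|)%:E <=
   r%:E * \int[mu]_(t in D) (dual_weight p w t)%:E +
   (r `^ (1 - p))%:E * energy p w D f)%E.
Proof.
move=> mD Dpos mf r0.
have md : measurable_fun D (EFin \o dual_weight p w).
  by apply/measurable_EFinP; exact: measurable_dual_weight.
have me := measurable_energy mD Dpos mf.
rewrite -ge0_integralZl//; last 2 first.
- by move=> t /(inpos Dpos) /dual_weight_gt0 /ltW; rewrite lee_fin.
- by rewrite lee_fin ltW.
rewrite /energy -ge0_integralZl//; last 2 first.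
- move=> t /(inpos Dpos) t0; rewrite lee_fin mulr_ge0 ?powR_ge0//.
  by rewrite ltW// w_gt0.
- by rewrite lee_fin powR_ge0.
rewrite -ge0_integralD//; last 4 first.
- move=> t /(inpos Dpos) /dual_weight_gt0 /ltW s0.
  by rewrite -EFinM lee_fin mulr_ge0// ltW.
- exact: measurable_funeM.
- move=> t /(inpos Dpos) t0; rewrite -EFinM lee_fin !mulr_ge0 ?powR_ge0//.
  by rewrite ltW// w_gt0.
- exact: measurable_funeM.
apply: ge0_le_integral => //.
- by apply/measurable_EFinP; exact: measurableT_comp.
- by apply: emeasurable_funD; exact: measurable_funeM.
- move=> t /(inpos Dpos) t0; rewrite -!EFinM -EFinD lee_fin.
  exact: le_dual_weight_energy.
Qed.

(** Choose r small in the previous bound first, and the energy small afterwards. *)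
Lemma L1_small_of_energy D : measurable D -> D `<=` pos ->
  (\int[mu]_(t in D) (dual_weight p w t)%:E < +oo)%E -> forall e, 0 < e ->
  exists2 d, 0 < d & forall f, measurable_fun D f -> (energy p w D f <= d%:E)%E ->
    (\int[mu]_(t in D) (`|f t|)%:E <= e%:E)%E.
Proof.
move=> mD Dpos sD e e0.
have S0 : (0 <= \int[mu]_(t in D) (dual_weight p w t)%:E)%E.
  by apply: integral_ge0 => t /(inpos Dpos) /dual_weight_gt0 /ltW; rewrite lee_fin.
have [s s0 sE] : exists2 s : R, 0 <= s & (\int[mu]_(t in D) (dual_weight p w t)%:E = s%:E)%E.
  exists (fine (\int[mu]_(t in D) (dual_weight p w t)%:E)%E); first exact: fine_ge0.
  by rewrite fineK// ge0_fin_numE.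
pose r := e / 2 / (s + 1).
have r0 : 0 < r by rewrite divr_gt0//; lra.
have rp : 0 < r `^ (1 - p) by rewrite powR_gt0.
exists (e / 2 / r `^ (1 - p)); first by rewrite divr_gt0//; lra.
move=> f mf fd; apply: le_trans (L1_le_energy mD Dpos mf r0) _.
rewrite [e in (_ <= e%:E)%E]splitr EFinD; apply: leeD.
  rewrite sE -EFinM lee_fin /r mulrAC ler_pdivrMr; last by lra.
  by rewrite ler_wpM2l//; lra.
apply: (@le_trans _ _ ((r `^ (1 - p))%:E * (e / 2 / r `^ (1 - p))%:E)%E).
  by rewrite lee_wpmul2l// lee_fin ltW.
by rewrite -EFinM lee_fin mulrC divfK// gt_eqF.
Qed.

Lemma integrable_of_energy D f : measurable D -> D `<=` pos -> measurable_fun D f ->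
  (\int[mu]_(t in D) (dual_weight p w t)%:E < +oo)%E ->
  (energy p w D f < +oo)%E -> mu.-integrable D (EFin \o f).
Proof.
move=> mD Dpos mf sD fD; apply/integrableP; split; first exact/measurable_EFinP.
under eq_integral do rewrite /=.
apply: le_lt_trans (L1_le_energy mD Dpos mf ltr01) _.
by rewrite mul1e powR1 mul1e lte_add_pinfty.
Qed.

Lemma weight_bounds a b : 0 < a -> a <= b -> exists m M,
  [/\ 0 < m, 0 < M & forall t, a <= t <= b -> m <= w t /\ w t <= M].
Proof.
move=> a0 ab.
have wab : {within `[a, b], continuous w}.
  apply: continuous_subspaceW w_cont => t /=; rewrite !in_itv /= andbT => /andP[? _]; lra.
have [c1 c1ab h1] := EVT_min ab wab; have [c2 c2ab h2] := EVT_max ab wab.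
exists (w c1), (w c2); split.
- by apply: w_gt0; move: c1ab; rewrite in_itv /= => /andP[]; lra.
- by apply: w_gt0; move: c2ab; rewrite in_itv /= => /andP[]; lra.
- by move=> t tab; split; [exact: h1|exact: h2].
Qed.

Lemma dual_weight_bounded a b : 0 < a -> a <= b -> exists2 M, 0 < M &
  forall t, a <= t <= b -> dual_weight p w t <= M.
Proof.
move=> a0 ab; have [m [M [m0 M0 H]]] := weight_bounds a0 ab.
exists (m `^ (- (p - 1)^-1)); first exact: powR_gt0.
move=> t /[dup] tab /H[h _]; rewrite /dual_weight !powRN lef_pV2 ?posrE ?powR_gt0//.
- apply: ge0_ler_powR; rewrite ?nnegrE ?invr_ge0//; [exact: ltW|exact: ltW|].
  exact: le_trans (ltW m0) h.
- exact: lt_le_trans m0 h.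
Qed.

Lemma dual_weight_integral_segment D a b : measurable D -> 0 < a -> a <= b ->
  D `<=` `[a, b] -> (\int[mu]_(t in D) (dual_weight p w t)%:E < +oo)%E.
Proof.
move=> mD a0 ab Dab.
have [M M0 H] := dual_weight_bounded a0 ab.
have abpos : `[a, b] `<=` pos.
  by move=> t /=; rewrite !in_itv /= andbT => /andP[? _]; lra.
have Dpos := subset_trans Dab abpos.
apply: (@le_lt_trans _ _ (\int[mu]_(t in D) (cst M%:E t))%E).
  apply: ge0_le_integral => //.
  - by move=> t /(inpos Dpos) /dual_weight_gt0 /ltW; rewrite lee_fin.
  - by apply/measurable_EFinP; exact: measurable_dual_weight.
  - by move=> t /Dab /=; rewrite in_itv /= lee_fin; exact: H.
rewrite integral_cst// lte_mul_pinfty ?lee_fin ?ltW//.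
have muab : (mu `[a, b]%classic < +oo)%E.
  by rewrite lebesgue_measure_itv /=; case: ifP => _; rewrite -?EFinB ltry.
apply: le_lt_trans muab; apply: le_measure; rewrite ?inE//.
Qed.

(** From (x + y)^p <= (2 max(x, y))^p. *)
Lemma energyD D f g : measurable D -> D `<=` pos -> measurable_fun D f -> measurable_fun D g ->
  (energy p w D (fun t => f t + g t)%R <=
   (2 `^ p)%:E * (energy p w D f + energy p w D g))%E.
Proof.
move=> mD Dpos mf mg; rewrite /energy.
have mef := measurable_energy mD Dpos mf; have meg := measurable_energy mD Dpos mg.
have e0 (h : R -> R) (t : R) : D t -> (0 <= (`|h t| `^ p * w t)%:E)%E.
  move=> /(inpos Dpos) t0; rewrite lee_fin mulr_ge0 ?powR_ge0//.
  by rewrite ltW// w_gt0.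
rewrite -ge0_integralD//; last 2 first.
- by move=> t; exact: e0.
- by move=> t; exact: e0.
rewrite -ge0_integralZl//; last 2 first.
- exact: emeasurable_funD.
- by move=> t Dt; rewrite adde_ge0//; exact: e0.
apply: ge0_le_integral => //.
- exact: (e0 (fun t => f t + g t)).
- by apply: (@measurable_energy _ (fun t => f t + g t)) => //; exact: measurable_funD.
- by apply: measurable_funeM; exact: emeasurable_funD.
move=> t /(inpos Dpos) t0; rewrite -EFinD -EFinM lee_fin -mulrDl mulrA.
rewrite ler_wpM2r ?(ltW (w_gt0 t0))//.
wlog fg : f g {mf mg mef meg} / `|g t| <= `|f t|.
  move=> H; have [|/ltW] := leP `|g t| `|f t|; first exact: H.
  by move=> /H; rewrite addrC [_ `^ p + _]addrC.
apply: (@le_trans _ _ ((2 * `|f t|) `^ p)).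
  apply: ge0_ler_powR; rewrite ?nnegrE ?mulr_ge0//; first exact: ltW.
  by rewrite (le_trans (ler_normD _ _))//; lra.
by rewrite powRM// ler_wpM2l ?powR_ge0// lerDl powR_ge0.
Qed.

Lemma wLnorm_le f e : 0 < e -> (energy p w pos f <= (e `^ p)%:E)%E = (wLnorm p w f <= e%:E)%E.
Proof.
move=> e0; have E0 := energy_ge0 f (@subset_refl _ pos).
apply/idP/idP => h.
- have -> : e%:E = ((e `^ p)%:E `^ p^-1)%E.
    by rewrite poweR_EFin -powRrM mulfV// powRr1// ltW.
  apply: gt0_ler_poweR => //; first by rewrite invr_ge0 ltW.
    by rewrite in_itv/= E0 leey.
  by rewrite in_itv/= lee_fin powR_ge0 leey.
- have -> : energy p w pos f = (wLnorm p w f `^ p)%E.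
    by rewrite /wLnorm -/(energy p w pos f) -poweRrM mulVf// poweRe1.
  rewrite -poweR_EFin; apply: gt0_ler_poweR => //; first exact: ltW.
    by rewrite in_itv/= poweR_ge0 leey.
  by rewrite in_itv/= lee_fin (ltW e0) leey.
Qed.

Lemma wLnorm_lty f : (wLnorm p w f < +oo)%E -> (energy p w pos f < +oo)%E.
Proof. by apply: lty_poweRy; rewrite invr_eq0. Qed.

Lemma wLnorm_cvg0 (f : nat -> R -> R) :
  wLnorm p w (f n) @[n --> \oo] --> 0%E <->
  forall e, 0 < e -> \forall n \near \oo, (energy p w pos (f n) <= e%:E)%E.
Proof.
split=> H.
  move=> e e0; have r0 : 0 < e `^ p^-1 by rewrite powR_gt0.
  have -> : e = (e `^ p^-1) `^ p by rewrite -powRrM mulVf// powRr1// ltW.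
  by apply: filterS (near_cvge0_le r0 H) => n; rewrite wLnorm_le.
apply/fine_cvgP; split.
  have := H 1 ltr01; apply: filterS => n.
  have := wLnorm_le (f n) ltr01; rewrite powR1 => -> h.
  by rewrite ge0_fin_numE ?poweR_ge0// (le_lt_trans h)// ltry.
apply/cvgrPdist_le => e e0.
have ep : 0 < e `^ p by rewrite powR_gt0.
apply: filterS (H _ ep) => n; rewrite wLnorm_le// => h.
rewrite sub0r normrN ger0_norm; last by rewrite fine_ge0// poweR_ge0.
by rewrite -lee_fin fineK// ge0_fin_numE ?poweR_ge0// (le_lt_trans h)// ltry.
Qed.

End weights.

(** * Supports, primitives and test functions *)

Section test_functions.
Context {R : realType}.
Notation mu := (@lebesgue_measure R).
Notation pos := (`]0, +oo[%classic : set R).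
Implicit Types (a b x y t e : R) (f g u phi : R -> R) (D E : set R).

Lemma integral_support D E f : E `<=` D ->
  (forall t, D t -> ~ E t -> f t = 0) ->
  (\int[mu]_(t in D) (f t)%:E = \int[mu]_(t in E) (f t)%:E)%E.
Proof.
move=> ED fE; rewrite integral_mkcond [RHS]integral_mkcond.
apply: eq_integral => t _; rewrite !patchE.
have [Et|nEt] := pselect (E t).
  by rewrite !mem_set//; exact: ED.
rewrite [t \in E]memNset//.
have [Dt|nDt] := pselect (D t); last by rewrite memNset.
by rewrite mem_set// fE.
Qed.

Lemma integrable_support D E f : measurable D -> measurable E ->
  (forall t, D t -> ~ E t -> f t = 0) ->
  mu.-integrable E (EFin \o f) -> mu.-integrable D (EFin \o f).
Proof.
move=> mD mE fE; rewrite integrable_mkcond// => iE.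
have iDE : mu.-integrable D ((EFin \o f) \_ E) by apply: integrableS iE.
apply: eq_integrable iDE => // t /set_mem Dt; rewrite patchE.
have [Et|nEt] := pselect (E t); first by rewrite mem_set.
by rewrite memNset//= fE.
Qed.

Lemma integrable_compact_support f a b : continuous f ->
  (forall t, ~ (a < t < b) -> f t = 0) -> mu.-integrable setT (EFin \o f).
Proof.
move=> cf f0; apply: (@integrable_support _ `[a, b]%classic) => //.
  by move=> t _ nt; apply: f0 => /andP[h1 h2]; apply: nt; rewrite /= in_itv /= !ltW.
apply: continuous_compact_integrable; first exact: segment_compact.
exact: continuous_subspaceT.
Qed.

Lemma continuous_primitive phi x y : (forall t, derivable phi t 1) ->
  continuous phi^`() -> x <= y ->
  \int[mu]_(t in `]x, y]) (phi^`())%classic t = phi y - phi x.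
Proof.
move=> dphi cphi'; rewrite le_eqVlt => /orP[/eqP <-|xy].
  by rewrite set_itvoc0 Rintegral_set0 subrr.
have cphi : continuous phi.
  by move=> t; apply/differentiable_continuous/derivable1_diffP.
rewrite Rintegral_itv_obnd_cbnd; last first.
  have icc : mu.-integrable `[x, y] (EFin \o phi^`()).
    apply: continuous_compact_integrable; first exact: segment_compact.
    exact: continuous_subspaceT.
  by apply: integrableS icc => //; exact: subset_itv_oc_cc.
have FTC : (\int[mu]_(t in `[x, y]) (derive1 phi t)%:E = (phi y)%:E - (phi x)%:E)%E.
  apply: (continuous_FTC2 xy); first exact: continuous_subspaceT.
    split; first by move=> t _; exact: dphi.
      exact/cvg_at_right_filter/cphi.
    exact/cvg_at_left_filter/cphi.
  by move=> t _.
by rewrite /Rintegral FTC.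
Qed.

Definition supported a b f := forall t, ~ (a < t < b) -> f t = 0.

Lemma primitive_from0 phi a b t : (forall t, derivable phi t 1) ->
  continuous phi^`() -> 0 < a -> supported a b phi -> 0 < t ->
  \int[mu]_(s in `]0, t]) (phi^`())%classic s = phi t.
Proof.
move=> dphi cphi' a0 phi0 t0; rewrite continuous_primitive//; last exact: ltW.
by rewrite [phi 0]phi0 ?subr0// => /andP[]; lra.
Qed.

Lemma primitive_to_infinity phi a b t : (forall t, derivable phi t 1) ->
  continuous phi^`() -> supported a b phi -> supported a b phi^`() ->
  \int[mu]_(s in `[t, +oo[) (phi^`())%classic s = - phi t.
Proof.
move=> dphi cphi' phi0 phi'0.
have iphi := integrable_compact_support cphi' phi'0.
pose c := Num.max t b.
have tc : t <= c by rewrite le_max lexx.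
have bc : b <= c by rewrite le_max lexx orbT.
rewrite -Rintegral_itv_obnd_cbnd; last by apply: integrableS iphi.
rewrite -[RHS]add0r -(phi0 c); last by move=> /andP[]; lra.
rewrite -continuous_primitive//; congr fine; apply: integral_support.
  by move=> s /=; rewrite !in_itv /= => /andP[-> _].
move=> s /=; rewrite !in_itv /= andbT => ts /negP; rewrite ts /= -ltNge => cs.
by apply: phi'0 => /andP[]; lra.
Qed.

(** Enclosing 1 as well lets values at 1 serve as integration constants. *)
Lemma compact_pos_segment K : compact K -> K `<=` pos -> exists a b,
  [/\ 0 < a, a <= 1, 1 <= b & K `<=` `[a, b]].
Proof.
move=> cK Kpos.
have [K0|/set0P nK] := eqVneq K set0.
  by exists 1, 1; rewrite K0; split.
have cid : {within K, continuous (@idfun R)} by apply: continuous_subspaceT => t.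
have [c cin cmin] := compact_EVT_min nK cK cid.
have [d din dmax] := compact_EVT_max nK cK cid.
have c0 : 0 < c by have := Kpos _ (set_mem cin); rewrite /= in_itv /= andbT.
exists (Num.min c 1), (Num.max d 1); split.
- by rewrite lt_min c0 ltr01.
- by rewrite ge_min lexx orbT.
- by rewrite le_max lexx orbT.
- move=> t Kt; have tK := mem_set Kt; rewrite /= in_itv /= ge_min le_max.
  by rewrite [c <= t](cmin _ tK) [t <= d](dmax _ tK).
Qed.

(** A margin is left around the support, so that the derivative vanishes up to and
    including the end points. *)
Lemma test_function_supported phi : test_function phi -> exists a b,
  [/\ 0 < a, supported a b phi & supported a b phi^`()].
Proof.
move=> [_ cK Kpos]; have [c [d [c0 _ _ Kcd]]] := compact_pos_segment cK Kpos.
have phi0 t : ~ (c <= t <= d) -> phi t = 0.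
  move=> nt; apply/eqP; apply: contraT => nz; exfalso; apply: nt.
  have /Kcd : closure [set t | phi t != 0] t by exact: subset_closure.
  by rewrite /= in_itv.
exists (c / 2), (d + 1); split; first by lra.
  by move=> t nt; apply: phi0 => /andP[h1 h2]; apply: nt; apply/andP; split; lra.
move=> t nt; rewrite derive1E.
have tcd : t < c \/ d < t.
  have [h|h] := ltP t c; [by left|right].
  by rewrite ltNge; apply/negP => h2; apply: nt; apply/andP; split; lra.
rewrite (@near_eq_derive _ _ _ phi (cst 0)) ?derive_cst//.
case: tcd => h; near=> s; apply: phi0 => /andP[h1 h2].
  have : s < c by near: s; exact: lt_nbhsl.
  lra.
have : d < s by near: s; exact: lt_nbhsr.
lra.
Unshelve. all: by end_near. Qed.

Lemma test_function_derivable phi : test_function phi -> forall t, derivable phi t 1.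
Proof. by move=> [d _ _] t; exact: (d 0%N). Qed.

Lemma test_function_continuous1 phi : test_function phi -> continuous phi^`().
Proof.
move=> [d _ _] t; apply/differentiable_continuous/derivable1_diffP.
exact: (d 1%N).
Qed.

(** A vanishing mean is exactly what makes the primitive vanish to the right of the
    support. *)
Lemma smooth_primitive_test (s : R -> R) a b : 0 < a -> smooth s -> supported a b s ->
  \int[mu]_(t in setT) s t = 0 ->
  let phi x := \int[mu]_(t in `]-oo, x]) s t in
  test_function phi /\ phi^`() = s.
Proof.
move=> a0 ss s0 is0 phi.
have cs := smooth_continuous ss.
have ints := integrable_compact_support cs s0.
have H x : derivable phi x 1 /\ (phi^`())%classic x = s x.
  apply: (@continuous_FTC1 _ s -oo%O x (x + 1)) => //.
  - by rewrite ltrDl.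
  - by apply: integrableS ints.
  - by rewrite ltNyr.
  - exact: cs.
have phi's : phi^`() = s by apply/funext => y; have [] := H y.
have phi0 x : ~ (a < x < b) -> phi x = 0.
  move=> nx; have [xa|ax] := leP x a.
    rewrite /phi (@eq_Rintegral _ _ _ _ _ (cst 0)) ?Rintegral_cst ?mul0r//.
    move=> t /set_mem /=; rewrite in_itv /= => tx; apply: s0 => /andP[]; lra.
  rewrite -is0 /phi; congr fine; apply/esym/integral_support => // t _ /=.
  rewrite in_itv /= => /negP; rewrite -ltNge => xt; apply: s0 => /andP[h1 h2].
  by apply: nx; rewrite ax /=; lra.
have clab : closure [set t | phi t != 0] `<=` `[a, b].
  have -> : `[a, b]%classic = closure `[a, b]%classic.
    by apply/closure_id; exact: itv_closed.
  apply: closure_subset => t /= nz; rewrite in_itv /=; apply/negPn/negP => nt.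
  move/eqP: nz; apply; apply: phi0 => /andP[h1 h2].
  by move: nt; rewrite !ltW.
split => //; split.
- apply: smooth_derivable => -[|n].
    by split => // y; have [] := H y.
  by split; [move=> y; have [] := H y|rewrite phi's; exact: ss].
- by apply: subclosed_compact clab; [exact: closed_closure|exact: segment_compact].
- move=> t /clab /=; rewrite !in_itv /= andbT => /andP[]; lra.
Qed.

End test_functions.

(** * Boundary behaviour of limits of test functions *)

Section boundary_values.
Context {R : realType}.
Notation mu := (@lebesgue_measure R).
Notation pos := (`]0, +oo[%classic : set R).
Implicit Types (a b x y t e : R) (f g u : R -> R) (D K : set R).

Lemma uniform_cvgP K (phi : nat -> R -> R) u :
  {uniform K, phi @ \oo --> u} <->
  forall e, 0 < e -> \forall n \near \oo, forall t, K t -> `|u t - phi n t| < e.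
Proof.
split=> H.
  move=> e e0; apply: (H [set h | forall t, K t -> `|u t - h t| < e]).
  apply/uniform_nbhs; exists [set xy | `|xy.1 - xy.2| < e]; split => //.
  by rewrite -entourage_ballE; exists e.
move=> P /uniform_nbhs [E []]; rewrite -entourage_ballE => -[e /= e0 eE] EP.
apply: filterS (H e e0) => n h; apply: EP => t Kt.
by apply: eE; exact: h.
Qed.

Variables (p : R) (w : R -> R).
Hypothesis hp : 1 < p.
Hypothesis w_gt0 : forall t : R, 0 < t -> 0 < w t.
Hypothesis w_cont : {within pos, continuous w}.

Lemma Bp0_itv t : Bp0 p w -> (\int[mu]_(s in `]0%R, t]) (dual_weight p w s)%:E < +oo)%E.
Proof.
rewrite /Bp0 /= -/(dual_weight p w _) => B.
pose c := Num.max 1 t.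
have m01 : measurable (`]0, 1] : set R) by exact: measurable_itv.
have m1c : measurable (`]1, c] : set R) by exact: measurable_itv.
have E : `]0, 1]%classic `|` `]1, c]%classic = `]0, c]%classic :> set R.
  by rewrite -itv_bndbnd_setU// bnd_simp// le_max lexx.
have cpos : (`]0, c] : set R) `<=` pos.
  by move=> s /=; rewrite !in_itv /= andbT => /andP[].
apply: (@le_lt_trans _ _ (\int[mu]_(s in `]0%R, c]) (dual_weight p w s)%:E)%E).
  apply: ge0_subset_integral => //.
  - by apply/measurable_EFinP; apply: measurable_dual_weight.
  - by move=> s _; rewrite lee_fin powR_ge0.
  - by move=> s /=; rewrite !in_itv /= le_max => /andP[-> ->]; rewrite orbT.
rewrite -E ge0_integral_setU//=; last 3 first.
- by rewrite E; apply/measurable_EFinP; exact: measurable_dual_weight.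
- by move=> s _; rewrite lee_fin powR_ge0.
- apply/disj_setPS => s [] /=; rewrite !in_itv /= => /andP[_ h1] /andP[h2 _].
  by have := le_lt_trans h1 h2; rewrite ltxx.
apply: lte_add_pinfty => //.
apply: (@dual_weight_integral_segment _ p w hp w_gt0 w_cont _ 1 c) => //.
  by rewrite le_max lexx.
by move=> s /=; rewrite !in_itv /= => /andP[/ltW -> ->].
Qed.

Lemma Bpinfty_itv t : 0 < t -> Bpinfty p w ->
  (\int[mu]_(s in `[t, +oo[) (dual_weight p w s)%:E < +oo)%E.
Proof.
move=> t0; rewrite /Bpinfty /= -/(dual_weight p w _) => B.
pose c := Num.min 1 t.
have c0 : 0 < c by rewrite lt_min ltr01.
have c1 : c <= 1 by rewrite ge_min lexx.
have m01 : measurable (`[c, 1[ : set R) by exact: measurable_itv.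
have m1c : measurable (`[1, +oo[ : set R) by exact: measurable_itv.
have E : `[c, 1[%classic `|` `[1, +oo[%classic = `[c, +oo[%classic :> set R.
  by rewrite -itv_bndbnd_setU// bnd_simp.
have cpos : (`[c, +oo[ : set R) `<=` pos.
  by move=> s /=; rewrite !in_itv /= !andbT; exact: lt_le_trans.
apply: (@le_lt_trans _ _ (\int[mu]_(s in `[c, +oo[) (dual_weight p w s)%:E)%E).
  apply: ge0_subset_integral => //.
  - by apply/measurable_EFinP; apply: measurable_dual_weight.
  - by move=> s _; rewrite lee_fin powR_ge0.
  - by move=> s /=; rewrite !in_itv /= ge_min !andbT => ->; rewrite orbT.
rewrite -E ge0_integral_setU//=; last 3 first.
- by rewrite E; apply/measurable_EFinP; exact: measurable_dual_weight.
- by move=> s _; rewrite lee_fin powR_ge0.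
- apply/disj_setPS => s [] /=; rewrite !in_itv /= andbT => /andP[_ h1] h2.
  by have := lt_le_trans h1 h2; rewrite ltxx.
apply: lte_add_pinfty => //.
apply: (@dual_weight_integral_segment _ p w hp w_gt0 w_cont _ c 1) => //.
by move=> s /=; rewrite !in_itv /= => /andP[-> /ltW ->].
Qed.

Lemma energy_subset D f : measurable D -> D `<=` pos -> measurable_fun pos f ->
  (energy p w D f <= energy p w pos f)%E.
Proof.
move=> mD Dpos mf; apply: ge0_subset_integral => //.
- by apply: measurable_energy.
- move=> t /=; rewrite in_itv /= andbT => t0.
  by rewrite lee_fin mulr_ge0 ?powR_ge0// ltW// w_gt0.
Qed.

Lemma Dirichlet_integrable u D : Dirichlet p w u -> measurable D -> D `<=` pos ->
  (\int[mu]_(t in D) (dual_weight p w t)%:E < +oo)%E ->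
  mu.-integrable D (EFin \o u^`()).
Proof.
move=> [_ [mu' u'fin]] mD Dpos sD.
apply: (integrable_of_energy hp w_gt0 w_cont) => //.
  exact: measurable_funS mu'.
apply: le_lt_trans (energy_subset mD Dpos mu') _.
exact: (wLnorm_lty hp).
Qed.

(** On a domain D where the dual weight is integrable, convergence in energy implies
    convergence in L1. A formula expressing the value at x of a test function by
    the integral of its derivative over D therefore passes to the limit. It is used
    with D = ]0, x] and c = 1, and with D = [x, +oo[ and c = -1. *)
Lemma Dirichlet0_boundary u D x (c : R) : measurable D -> D `<=` pos -> 0 < x ->
  (\int[mu]_(t in D) (dual_weight p w t)%:E < +oo)%E ->
  (forall phi, test_function phi -> \int[mu]_(t in D) (phi^`())%classic t = c * phi x) ->
  Dirichlet0 p w u ->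
  mu.-integrable D (EFin \o u^`()) /\ \int[mu]_(t in D) (u^`())%classic t = c * u x.
Proof.
move=> mD Dpos x0 sD phiE [Du [phi [tphi phi'cvg phicvg]]].
have iu := Dirichlet_integrable Du mD Dpos sD; split => //.
have mu' : measurable_fun pos u^`() by case: Du => _ [].
have mphi' n : measurable_fun pos (phi n)^`().
  apply: (@measurable_funS _ _ _ _ setT) => //; apply: continuous_measurable_fun.
  exact: test_function_continuous1.
have key : (fun n => \int[mu]_(t in D) ((phi n)^`())%classic t) @ \oo -->
    \int[mu]_(t in D) (u^`())%classic t.
  apply/cvgrPdist_le => e e0.
  have [d d0 Hd] := L1_small_of_energy hp w_gt0 w_cont mD Dpos sD e0.
  have := (wLnorm_cvg0 hp w_gt0 _).1 phi'cvg d d0; apply: filterS => n En.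
  pose df : R -> R := (phi n)^`() \- u^`().
  have mdiff : measurable_fun pos df by exact: measurable_funB.
  have En' : (energy p w D df <= d%:E)%E.
    exact: le_trans (energy_subset mD Dpos mdiff) En.
  have mdiffD : measurable_fun D df.
    exact: measurable_funS mdiff.
  have L1 := Hd _ mdiffD En'.
  have idiff : mu.-integrable D (EFin \o df).
    apply: (integrable_of_energy hp w_gt0 w_cont) => //.
    by apply: le_lt_trans En' _; rewrite ltry.
  have iphi : mu.-integrable D (EFin \o (phi n)^`()).
    have := @integrableD _ _ _ mu D mD _ _ idiff iu; apply: eq_integrable => // t _ /=.
    by rewrite /df -EFinD subrK.
  rewrite distrC -RintegralB//.
  exact: normr_Rintegral_le L1.
apply: (cvg_unique _ key); first exact: Rhausdorff.
have -> : (fun n => \int[mu]_(t in D) ((phi n)^`())%classic t) = (fun n => c * phi n x).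
  by apply/funext => n; exact: phiE.
apply: cvgM; first exact: cvg_cst.
apply/cvgrPdist_lt => e e0.
have cK : compact [set x] by exact: compact_set1.
have Kpos : [set x] `<=` pos by move=> t ->; rewrite /= in_itv /= x0.
have /uniform_cvgP/(_ e e0) := phicvg _ cK Kpos.
by apply: filterS => n; exact.
Qed.

Lemma Dirichlet0_Rzero u : Bp0 p w -> Dirichlet0 p w u -> Rzero p w u.
Proof.
move=> B D0u; split; first by case: D0u.
move=> t t0; have [//|||||i E] := @Dirichlet0_boundary u `]0, t]%classic t 1 _ _ _ _ _ D0u.
- by move=> s /=; rewrite !in_itv /= andbT => /andP[].
- exact: t0.
- exact: Bp0_itv.
- move=> phi tphi; have [a [b [a0 s1 s2]]] := test_function_supported tphi.
  rewrite mul1r (@primitive_from0 _ _ a b)//.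
    exact: test_function_derivable.
  exact: test_function_continuous1.
- by split => //; rewrite E mul1r.
Qed.

Lemma Dirichlet0_Rinfty u : Bpinfty p w -> Dirichlet0 p w u -> Rinfty p w u.
Proof.
move=> B D0u; have Du : Dirichlet p w u by case: D0u.
split => //; exists (\- u^`()).
  case: Du => _ [mu' u'fin]; split; first exact: measurableT_comp.
  rewrite /wLnorm; under eq_integral do rewrite normrN.
  exact: u'fin.
move=> t t0; have [//|||||i E] := @Dirichlet0_boundary u `[t, +oo[%classic t (-1) _ _ _ _ _ D0u.
- by move=> s /=; rewrite !in_itv /= !andbT; exact: lt_le_trans.
- exact: t0.
- exact: Bpinfty_itv.
- move=> phi tphi; have [a [b [a0 s1 s2]]] := test_function_supported tphi.
  rewrite mulN1r (@primitive_to_infinity _ _ a b)//.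
    exact: test_function_derivable.
  exact: test_function_continuous1.
- split; first by have := @integrableN _ _ _ mu _ _ i; apply: eq_integrable.
  transitivity (-1 * \int[mu]_(s in `[t, +oo[) (u^`())%classic s).
    by rewrite E mulrA mulN1r opprK mul1r.
  rewrite -RintegralZl//; apply: eq_Rintegral => s _; exact: mulN1r.
Qed.

End boundary_values.

(** * Approximation in energy with prescribed integrals *)

Section approximation.
Context {R : realType}.
Notation mu := (@lebesgue_measure R).
Notation pos := (`]0, +oo[%classic : set R).
Implicit Types (a b c x y t e M : R) (f g h u : R -> R) (D A : set R).

(** Bounded, with support in D and away from 0 and infinity: the functions to
    which smoothing applies. *)
Definition tame D g := measurable_fun setT g /\ exists a b M,
  [/\ 0 < a, a < b, forall t, `|g t| <= M & forall t, ~ (D t /\ a < t <= b) -> g t = 0].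

Lemma tame_add D1 D2 f g : tame D1 f -> tame D2 g ->
  tame (D1 `|` D2) (fun t => f t + g t).
Proof.
move=> [mf [a [b [M [a0 ab fM f0]]]]] [mg [c [d [N [c0 cd gN g0]]]]]; split.
  exact: measurable_funD.
exists (Num.min a c), (Num.max b d), (M + N); split.
- by rewrite lt_min a0.
- by rewrite gt_min !lt_max ab.
- by move=> t; rewrite (le_trans (ler_normD _ _))// lerD.
- move=> t nt; rewrite f0 ?g0 ?addr0// => -[Dt /andP[h1 h2]]; apply: nt.
    by split; [right|rewrite gt_min le_max h1 h2 !orbT].
  by split; [left|rewrite gt_min le_max h1 h2].
Qed.

Lemma tame_integrable D E g : measurable E -> tame D g -> mu.-integrable E (EFin \o g).
Proof.
move=> mE [mg [a [b [M [a0 ab gM g0]]]]].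
apply: (@integrable_support _ _ `]a, b]%classic) => //.
  by move=> t _ nt; apply: g0 => -[_ h]; apply: nt; rewrite /= in_itv.
apply: measurable_bounded_integrable => //.
- rewrite /= lebesgue_measure_itv /=; case: ifP => _; rewrite -?EFinB ltry//.
- exact: measurable_funS mg.
- exists M; split; first exact: num_real.
  by move=> N MN t _; exact: le_trans (gM t) (ltW MN).
Qed.

(** Cutting an integrable function off to sets that eventually contain every point. *)
Lemma integral_exhaust D (A : nat -> set R) f : measurable D ->
  (forall n, measurable (A n)) -> (forall t, D t -> \forall n \near \oo, A n t) ->
  mu.-integrable D (EFin \o f) ->
  (\int[mu]_(t in D) (f \_ (A n)) t) @[n --> \oo] --> \int[mu]_(t in D) f t.
Proof.
move=> mD mA cA intf.
have mf : measurable_fun D f by apply/measurable_EFinP; exact: measurable_int intf.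
apply: fine_cvg; rewrite fineK; last exact: integrable_fin_num.
apply: (@dominated_cvg _ _ _ mu _ mD _ _ (fun t => `|f t|%:E)).
- move=> n; apply/measurable_EFinP.
  apply/measurable_restrict; [exact: mA|exact: mD|].
  by apply: measurable_funS mf => //; exact: subIsetl.
- move=> t Dt; apply: cvg_near_cst; have := cA t Dt; apply: filterS => n Ant.
  by rewrite patchE mem_set.
- by [].
- exact: (integrable_norm intf).
- move=> n t _ /=; rewrite lee_fin patchE; case: ifP => // _.
  by rewrite normr0.
Qed.

Variables (p : R) (w : R -> R).
Hypothesis hp : 1 < p.
Hypothesis w_gt0 : forall t : R, 0 < t -> 0 < w t.
Hypothesis w_cont : {within pos, continuous w}.

Let p0 : 0 < p. Proof. exact: lt_trans ltr01 hp. Qed.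
Let pN0 : p != 0. Proof. by rewrite gt_eqF. Qed.

Definition box (n : nat) : set R := `[n.+1%:R^-1, n.+1%:R]%classic.

Lemma nbhs_infty_gerS (r : R) : \forall n \near \oo, r <= n.+1%:R.
Proof.
by have := nbhs_infty_ger r; apply: filterS => n rn; rewrite (le_trans rn)// ler_nat.
Qed.

Lemma box_near t : 0 < t -> \forall n \near \oo, box n t.
Proof.
move=> t0; near=> n; rewrite /box /= in_itv /=; apply/andP; split; last first.
  by near: n; exact: nbhs_infty_gerS.
rewrite invf_ple ?posrE//.
by near: n; exact: nbhs_infty_gerS.
Unshelve. all: by end_near. Qed.

(** The part of D away from 0 and infinity on which f is also bounded; cutting f off
    outside makes it tame. *)
Definition core D f n : set R := D `&` (box n `&` [set t | `|f t| <= n.+1%:R]).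

Lemma measurable_core D f n : measurable D -> measurable_fun D f ->
  measurable (core D f n).
Proof.
move=> mD mf; have -> : core D f n = box n `&` (D `&` [set t | `|f t| <= n.+1%:R]).
  by rewrite /core setICA.
apply: measurableI; first exact: measurable_itv.
by apply: measurable_fun_le => //; exact: measurableT_comp.
Qed.

Lemma core_near D f t : D `<=` pos -> D t -> \forall n \near \oo, core D f n t.
Proof.
move=> Dpos Dt; have t0 : 0 < t by have := Dpos _ Dt; rewrite /= in_itv /= andbT.
by apply: filterS2 (box_near t0) (nbhs_infty_gerS `|f t|) => n bt ft; split.
Qed.

Lemma tame_box D g n M : measurable_fun setT g -> (forall t, `|g t| <= M) ->
  (forall t, ~ (D t /\ box n t) -> g t = 0) -> tame D g.
Proof.
move=> mg gM g0; split => //.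
(* the left end is halved because tame supports are left-open *)
exists (n.+1%:R^-1 / 2), (n.+1%:R + 1), M; split => //.
- have h1 : (1 : R) <= n.+1%:R by rewrite ler1n.
  have h2 : n.+1%:R^-1 <= (1 : R) by rewrite invf_le1.
  have : n.+1%:R^-1 / 2 <= (1 : R) by move: h2; move: (n.+1%:R^-1 : R) => z; lra.
  by move=> h; rewrite (le_lt_trans h)// ltr_pwDl.
- move=> t nt; apply: g0 => -[Dt]; rewrite /box /= in_itv /= => /andP[h1 h2].
  apply: nt; split => //; apply/andP; split; last by lra.
  by apply: lt_le_trans h1; rewrite gtr_pMr// invf_lt1// ltr1n.
Qed.

Lemma tame_core D f n : measurable D -> measurable_fun D f ->
  tame D (f \_ (core D f n)).
Proof.
move=> mD mf; apply: (@tame_box _ _ n n.+1%:R).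
- apply/(measurable_restrictT _ (measurable_core n mD mf)).
  by apply: measurable_funS mf => //; exact: subIsetl.
- move=> t; rewrite patchE; case: ifPn => [/set_mem[_ []//]|_].
  by rewrite normr0.
- move=> t nt; rewrite patchE memNset// => -[Dt [bt _]]; exact: nt.
Qed.

Lemma energy_core D f : measurable D -> D `<=` pos -> measurable_fun D f ->
  (energy p w D f < +oo)%E -> forall e, 0 < e ->
  \forall n \near \oo, (energy p w D (fun t => ((f \_ (core D f n)) t - f t)%R) <= e%:E)%E.
Proof.
move=> mD Dpos mf Ef e e0.
have mcut n : measurable_fun D (fun t => (f \_ (core D f n)) t - f t).
  apply: measurable_funB => //.
  by apply: measurable_funS (tame_core n mD mf).1.
have wpos t : D t -> 0 < w t.
  by move=> /Dpos /=; rewrite in_itv /= andbT; exact: w_gt0.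
have H : energy p w D (fun t => ((f \_ (core D f n)) t - f t)%R) @[n --> \oo]
    --> (\int[mu]_(t in D) cst 0 t)%E.
  apply: (@dominated_cvg _ _ _ mu _ mD _ _ (fun t => (`|f t| `^ p * w t)%:E)).
  - by move=> n; exact: measurable_energy.
  - move=> t Dt; apply: cvg_near_cst; have := core_near f Dpos Dt; apply: filterS => n At.
    by rewrite patchE mem_set// subrr normr0 powR0// mul0r.
  - by [].
  - apply/integrableP; split; first exact: measurable_energy.
    apply: le_lt_trans Ef; rewrite le_eqVlt; apply/orP; left; apply/eqP.
    apply: eq_integral => t /set_mem Dt; rewrite gee0_abs// lee_fin.
    by rewrite mulr_ge0 ?powR_ge0// ltW// wpos.
  - move=> n t Dt /=; rewrite lee_fin ger0_norm; last first.
      by rewrite mulr_ge0 ?powR_ge0// ltW// wpos.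
    rewrite ler_wpM2r//; first by rewrite ltW// wpos.
    rewrite patchE; case: ifP => _; last by rewrite sub0r normrN.
    by rewrite subrr normr0 powR0// powR_ge0.
rewrite integral0 in H.
exact: near_cvge0_le H.
Qed.

Lemma dual_weight_box D : measurable D -> D `<=` pos ->
  (\int[mu]_(t in D) (dual_weight p w t)%:E = +oo)%E -> forall L : R, exists n,
  exists2 S : R, L <= S & (\int[mu]_(t in D `&` box n) (dual_weight p w t)%:E = S%:E)%E.
Proof.
move=> mD Dpos sD L.
have mbox n : measurable (D `&` box n) by apply: measurableI => //; exact: measurable_itv.
have mdw : measurable_fun D (EFin \o dual_weight p w).
  by apply/measurable_EFinP; exact: measurable_dual_weight.
pose s n t := ((EFin \o dual_weight p w) \_ (box n)) t.
have boxS n m : (n <= m)%N -> box n `<=` box m.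
  move=> nm t; rewrite /box /= !in_itv /= => /andP[h1 h2]; apply/andP; split.
    by apply: le_trans h1; rewrite lef_pV2 ?posrE// ler_nat.
  by apply: le_trans h2 _; rewrite ler_nat.
have sE n : (\int[mu]_(t in D) s n t = \int[mu]_(t in D `&` box n) (dual_weight p w t)%:E)%E.
  by rewrite integral_mkcondr.
have cvgs : (\int[mu]_(t in D) s n t)%E @[n --> \oo] -->
    (\int[mu]_(t in D) (fun t => limn (s^~ t)) t)%E.
  apply: (@cvg_monotone_convergence _ _ _ mu _ mD s).
  - move=> n; apply/measurable_restrict => //; first exact: measurable_itv.
    by apply: measurable_funS mdw.
  - by move=> n t _; rewrite /s patchE; case: ifP => // _; rewrite lee_fin powR_ge0.
  - move=> t _ n m nm; rewrite /s !patchE; case: ifPn => [/set_mem bn|_].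
      by rewrite mem_set//; exact: boxS bn.
    by case: ifP => // _; rewrite lee_fin powR_ge0.
have slim : (\int[mu]_(t in D) (fun t => limn (s^~ t)) t = +oo)%E.
  rewrite -sD; apply: eq_integral => t /set_mem Dt.
  apply: cvg_lim => //; apply: cvg_near_cst.
  have t0 : 0 < t by have := Dpos _ Dt; rewrite /= in_itv /= andbT.
  by apply: filterS (box_near t0) => n bn; rewrite /s patchE mem_set.
rewrite slim in cvgs.
move/cvgeyPge/(_ L) : cvgs => [n _ /(_ n (leqnn n)) /= Ln].
rewrite sE in Ln; exists n.
have fin : (\int[mu]_(t in D `&` box n) (dual_weight p w t)%:E < +oo)%E.
  apply: (@dual_weight_integral_segment _ p w hp w_gt0 w_cont _ n.+1%:R^-1 n.+1%:R) => //.
    by rewrite (@le_trans _ _ 1)// ?invf_le1// ler1n.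
have dfin : (\int[mu]_(t in D `&` box n) (dual_weight p w t)%:E)%E \is a fin_num.
  rewrite ge0_fin_numE//; apply: integral_ge0 => t _; rewrite lee_fin; exact: powR_ge0.
exists (fine (\int[mu]_(t in D `&` box n) (dual_weight p w t)%:E)%E).
  by rewrite -lee_fin fineK.
by rewrite fineK.
Qed.

Lemma energyZ D (k : R) f : measurable D -> D `<=` pos -> measurable_fun D f ->
  (energy p w D (fun t => (k * f t)%R) = (`|k| `^ p)%:E * energy p w D f)%E.
Proof.
move=> mD Dpos mf; rewrite /energy -ge0_integralZl//.
- by apply: eq_integral => t _; rewrite -EFinM normrM powRM// mulrA.
- exact: measurable_energy.
- move=> t /Dpos /=; rewrite in_itv /= andbT => t0.
  by rewrite lee_fin mulr_ge0 ?powR_ge0// ltW// w_gt0.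
Qed.

(** If the dual weight s is not integrable on D, integrals over D can be prescribed
    at no cost: with S the integral of s over a large box, (c / S) s restricted to
    this box has integral c, but energy |c|^p S^(1-p), which is small. *)
Lemma cheap_corrector D : measurable D -> D `<=` pos ->
  (\int[mu]_(t in D) (dual_weight p w t)%:E = +oo)%E -> forall (c e : R), 0 < e ->
  exists h, [/\ tame D h, (energy p w D h <= e%:E)%E & \int[mu]_(t in D) h t = c].
Proof.
move=> mD Dpos sD c e e0.
have q0 : 0 < p - 1 by rewrite subr_gt0.
(* S >= L gives |c|^p S^(1-p) <= e; the summand 1 makes L positive *)
pose L := (`|c| `^ p / e) `^ (p - 1)^-1 + 1.
have L0 : 0 < L by rewrite ltr_wpDl ?powR_ge0.
have [n [S LS SE]] := dual_weight_box mD Dpos sD L.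
have S0 : 0 < S := lt_le_trans L0 LS.
have mbox : measurable (D `&` box n) by apply: measurableI => //; exact: measurable_itv.
pose s := dual_weight p w \_ (D `&` box n).
have boxpos : D `&` box n `<=` pos by move=> t [/Dpos].
have ms : measurable_fun setT s.
  by apply/(measurable_restrictT _ mbox); exact: measurable_dual_weight.
have [M M0 HM] : exists2 M, 0 < M & forall t, n.+1%:R^-1 <= t <= n.+1%:R -> dual_weight p w t <= M.
  apply: dual_weight_bounded => //.
  by rewrite (@le_trans _ _ 1)// ?invf_le1// ler1n.
pose k := c / S.
have msD : measurable_fun D s by exact: measurable_funS ms.
have sint : (\int[mu]_(t in D) (s t)%:E = S%:E)%E.
  rewrite -SE; transitivity (\int[mu]_(t in D `&` box n) (s t)%:E)%E.
    by apply: integral_support => // t Dt nt; rewrite /s patchE memNset.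
  by apply: eq_integral => t tb; rewrite /s patchE tb.
have sen : energy p w D s = S%:E.
  rewrite -sint; apply: eq_integral => t /set_mem Dt; rewrite /s patchE.
  case: ifPn => [/set_mem [_ _]|_]; last by rewrite normr0 powR0// mul0r.
  have t0 : 0 < t by have := Dpos _ Dt; rewrite /= in_itv /= andbT.
  by rewrite ger0_norm ?powR_ge0// dual_weight_energy.
exists (fun t => k * s t); split.
- apply: (@tame_box _ _ n (`|k| * M)).
  + exact: measurable_funM.
  + move=> t; rewrite normrM ler_wpM2l// /s patchE; case: ifPn => [/set_mem [_ bt]|_].
      by rewrite ger0_norm ?powR_ge0// HM//; move: bt; rewrite /box /= in_itv.
    by rewrite normr0 ltW.
  + by move=> t nt; rewrite /s patchE memNset ?mulr0.
- rewrite energyZ// sen -EFinM lee_fin.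
  rewrite /k normrM normfV (gtr0_norm S0) powRM ?invr_ge0 ?(ltW S0)//.
  rewrite -powR_inv1 ?(ltW S0)// -powRrM mulN1r.
  rewrite -mulrA -{2}[S](@powRr1 _ _ (ltW S0)) -powRD; last by rewrite (gt_eqF S0) implybT.
  rewrite (_ : - p + 1 = - (p - 1)); last by ring.
  rewrite powRN ler_pdivrMr ?powR_gt0// mulrC -ler_pdivrMr//.
  have -> : `|c| `^ p / e = ((`|c| `^ p / e) `^ (p - 1)^-1) `^ (p - 1).
    by rewrite -powRrM mulVf ?powRr1 ?gt_eqF// divr_ge0 ?powR_ge0// ltW.
  apply: ge0_ler_powR; rewrite ?nnegrE ?powR_ge0 ?(ltW S0) ?(ltW q0)//.
  by rewrite (le_trans _ LS)// /L lerDl.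
- rewrite RintegralZl//; last first.
    apply/integrableP; split; first exact/measurable_EFinP.
    apply: (@le_lt_trans _ _ S%:E); last by rewrite ltry.
    rewrite -sint le_eqVlt; apply/orP; left; apply/eqP; apply: eq_integral => t _ /=.
    by rewrite ger0_norm// /s patchE; case: ifP => // _; exact: powR_ge0.
  by rewrite /Rintegral sint /= /k divfK// gt_eqF.
Qed.

(** The dichotomy behind the four cases. Cutting f off to its core is a good
    approximation in energy; its integral tends to that of f when f is integrable,
    and is corrected to the prescribed value c by cheap_corrector when the dual
    weight is not integrable. *)
Lemma half_approximation D f c : measurable D -> D `<=` pos -> measurable_fun D f ->
  (energy p w D f < +oo)%E ->
  (\int[mu]_(t in D) (dual_weight p w t)%:E = +oo)%E \/
    (mu.-integrable D (EFin \o f) /\ \int[mu]_(t in D) f t = c) ->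
  forall e, 0 < e -> exists g, [/\ tame D g,
    (energy p w D (fun t => (g t - f t)%R) <= e%:E)%E &
    `|\int[mu]_(t in D) g t - c| <= e].
Proof.
move=> mD Dpos mf Ef [sD|[intf fc]] e e0.
  have P0 : 0 < 2 `^ p :> R by rewrite powR_gt0.
  have e1 : 0 < e / 2 / 2 `^ p by rewrite !divr_gt0.
  have [n _ /(_ n (leqnn n)) /= En] := energy_core mD Dpos mf Ef e1.
  have tf := tame_core n mD mf.
  set f1 := f \_ (core D f n) in En tf.
  have [h [th Eh hc]] := cheap_corrector mD Dpos sD (c - \int[mu]_(t in D) f1 t) e1.
  exists (fun t => f1 t + h t); split.
  - by have := tame_add tf th; rewrite setUid.
  - have m1 : measurable_fun D (fun t => f1 t - f t).
      by apply: measurable_funB => //; apply: measurable_funS tf.1.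
    have m2 : measurable_fun D h by apply: measurable_funS th.1.
    have := energyD hp w_gt0 w_cont mD Dpos m1 m2.
    rewrite (_ : (fun t => f1 t - f t + h t) = (fun t => f1 t + h t - f t)); last first.
      by apply/funext => t; ring.
    move=> /le_trans; apply.
    apply: (@le_trans _ _ ((2 `^ p)%:E * ((e / 2 / 2 `^ p)%:E + (e / 2 / 2 `^ p)%:E))%E).
      apply: lee_wpmul2l; first by rewrite lee_fin ltW.
      exact: leeD.
    rewrite -EFinD -EFinM lee_fin -mulrDl mulrC divfK ?gt_eqF//; lra.
  - rewrite RintegralD//; last 2 first.
    + exact: tame_integrable tf.
    + exact: tame_integrable th.
    by rewrite hc (_ : _ - c = 0) ?normr0 ?ltW//; ring.
have := integral_exhaust mD (fun n => measurable_core n mD mf)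
  (fun t => @core_near D f t Dpos) intf.
move=> /cvgrPdist_le/(_ _ e0) H1; have H2 := energy_core mD Dpos mf Ef e0.
have [n _ /(_ n (leqnn n)) /= [h1 h2]] := filterI H1 H2.
exists (f \_ (core D f n)); split => //; first exact: tame_core.
by rewrite -fc distrC.
Qed.

(** Since x^p <= M^(p-1) x for 0 <= x <= M. *)
Lemma energy_le_L1 D W M f : measurable D -> D `<=` pos -> measurable_fun D f ->
  (forall t, D t -> w t <= W) -> 0 <= W -> 0 <= M -> (forall t, `|f t| <= M) ->
  (energy p w D f <= (W * M `^ (p - 1))%:E * \int[mu]_(t in D) (`|f t|)%:E)%E.
Proof.
move=> mD Dpos mf wW W0 M0 fM; rewrite -ge0_integralZl//; last 2 first.
- by apply/measurable_EFinP; exact: measurableT_comp.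
- by rewrite lee_fin mulr_ge0// powR_ge0.
have q0 : 0 < p - 1 by rewrite subr_gt0.
apply: ge0_le_integral => //.
- move=> t /Dpos /=; rewrite in_itv /= andbT => t0.
  by rewrite lee_fin mulr_ge0 ?powR_ge0// ltW// w_gt0.
- exact: measurable_energy.
- by apply: measurable_funeM; apply/measurable_EFinP; exact: measurableT_comp.
move=> t Dt; rewrite -EFinM lee_fin.
have -> : `|f t| `^ p * w t = w t * `|f t| `^ (p - 1) * `|f t|.
  by rewrite -mulr_powRB1//; ring.
rewrite ler_wpM2r// ler_pM ?powR_ge0 ?wW//.
  have := Dpos _ Dt; rewrite /= in_itv /= andbT => /w_gt0; exact: ltW.
by apply: ge0_ler_powR; rewrite ?nnegrE ?(ltW q0).
Qed.

Lemma tame_smooth g e : tame pos g -> 0 < e ->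
  exists s a b, [/\ 0 < a, smooth s, supported a b s,
    (energy p w pos (fun t => (s t - g t)%R) <= e%:E)%E &
    (\int[mu]_(t in pos) (`|s t - g t|)%:E <= e%:E)%E].
Proof.
move=> [mg [a [b [M [a0 ab gM g0]]]]] e0.
have M0 : 0 <= M by rewrite (le_trans _ (gM 0)).
have [m [W [m0 W0 HW]]] := weight_bounds w_gt0 w_cont a0 (ltW ab).
(* s - g is bounded by M + M, hence its energy by C times its L1 norm *)
pose C := W * (M + M) `^ (p - 1).
have C0 : 0 <= C by rewrite mulr_ge0 ?powR_ge0// ltW.
have e1 : 0 < e / (C + 1) by rewrite divr_gt0//; lra.
have mgab : measurable_fun (`]a, b] : set R) g by apply: measurable_funS mg.
have [s [ss s0 sM] sg] := smooth_approx ab e1 mgab gM.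
have abpos : (`]a, b] : set R) `<=` pos.
  move=> t /=; rewrite !in_itv /= andbT => /andP[h _]; lra.
have out t : pos t -> ~ (`]a, b]%classic t) -> s t - g t = 0.
  move=> pt nt; rewrite s0 ?g0 ?subrr//.
    by move=> [_ h]; apply: nt; rewrite /= in_itv.
  by move=> /andP[h1 h2]; apply: nt; rewrite /= in_itv /= h1 ltW.
have ms : measurable_fun setT s by exact: smooth_measurable.
have sgE : (\int[mu]_(t in `]a, b]) (`|s t - g t|)%:E <= (e / (C + 1))%:E)%E.
  by under eq_integral do rewrite distrC.
have Ce : e / (C + 1) * (C + 1) = e by rewrite divfK//; lra.
exists s, a, b; split => //.
- have -> : energy p w pos (fun t => s t - g t) = energy p w `]a, b]%classic (fun t => s t - g t).
    apply: integral_support => // t pt nt; rewrite out// normr0 powR0// mul0r//.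
  apply: (@le_trans _ _ (C%:E * (e / (C + 1))%:E)%E).
    apply: le_trans (@energy_le_L1 _ W (M + M) _ _ _ _ _ _ _ _) _ => //.
    + by apply: measurable_funB => //; exact: measurable_funS ms.
    + move=> t /=; rewrite in_itv /= => /andP[h1 h2]; have [] := HW t => //.
      by rewrite h2 ltW.
    + exact: ltW.
    + exact: addr_ge0.
    + by move=> t; rewrite (le_trans (ler_normB _ _))// lerD.
    by rewrite lee_wpmul2l.
  rewrite -EFinM lee_fin -[leRHS]Ce mulrC ler_wpM2l//; first exact: ltW.
  by rewrite lerDl.
- have -> : (\int[mu]_(t in pos) (`|s t - g t|)%:E = \int[mu]_(t in `]a, b]) (`|s t - g t|)%:E)%E.
    by apply: integral_support => // t pt nt; rewrite out// normr0.
  apply: le_trans sgE _; rewrite lee_fin ler_pdivrMr; last by lra.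
  by rewrite ler_peMr ?(ltW e0)// lerDr.
Qed.

End approximation.

(** * Membership in the closure of the test functions *)

Section assembly.
Context {R : realType}.
Notation mu := (@lebesgue_measure R).
Notation pos := (`]0, +oo[%classic : set R).
Implicit Types (a b c x y t e : R) (f g h u s : R -> R) (D A K : set R).

Variables (p : R) (w : R -> R).
Hypothesis hp : 1 < p.
Hypothesis w_gt0 : forall t : R, 0 < t -> 0 < w t.
Hypothesis w_cont : {within pos, continuous w}.

(** L1-closeness of the derivatives on [a, b] controls increments uniformly; for u
    this rests on the fundamental theorem of calculus. *)
Lemma increment_le u phi a b x y e : loc_abs_cont u -> measurable_fun pos u^`() ->
  (forall t, derivable phi t 1) -> continuous phi^`() -> 0 < a ->
  (\int[mu]_(t in `[a, b]) (`|derive1 phi t - derive1 u t|)%:E <= e%:E)%E ->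
  a <= x -> x <= y -> y <= b ->
  `|(phi y - u y) - (phi x - u x)| <= e.
Proof.
move=> acu mu' dphi cphi' a0 L1 ax xy yb.
have [iu uE] := loc_abs_cont_FTC acu mu' (lt_le_trans a0 ax) xy.
have phiE := continuous_primitive dphi cphi' xy.
have iphi : mu.-integrable `]x, y] (EFin \o phi^`()).
  have icc : mu.-integrable `[x, y] (EFin \o phi^`()).
    apply: continuous_compact_integrable; first exact: segment_compact.
    exact: continuous_subspaceT.
  by apply: integrableS icc => //; exact: subset_itv_oc_cc.
rewrite (_ : _ - _ = (phi y - phi x) - (u y - u x)); last by ring.
rewrite -phiE uE -RintegralB//.
have mxy : measurable (`]x, y] : set R) by exact: measurable_itv.
have idf := @integrableB _ _ _ mu _ mxy _ _ iphi iu.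
apply: (normr_Rintegral_le mxy idf); apply: le_trans L1.
have abpos : (`[a, b] : set R) `<=` pos.
  by move=> t /=; rewrite !in_itv /= andbT => /andP[h _]; exact: lt_le_trans h.
apply: ge0_subset_integral => //.
- apply/measurable_EFinP; apply: measurableT_comp => //; apply: measurable_funB.
    apply: (@measurable_funS _ _ _ _ setT) => //; exact: continuous_measurable_fun.
  exact: measurable_funS mu'.
- move=> t /=; rewrite !in_itv /= => /andP[h1 h2].
  by rewrite (le_trans ax (ltW h1)) (le_trans h2 yb).
Qed.

(** The derivative of u is approximated in energy by smooth functions s with compact
    support in the half-line whose integral over ]0, 1] is close to u 1; P s e is
    a further condition on s, in the sequel one on its mean. *)
Definition approximable u (P : (R -> R) -> R -> Prop) := forall e, 0 < e ->
  exists s a b, [/\ 0 < a, smooth s, supported a b s &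
   [/\ (energy p w pos (fun t => (s t - derive1 u t)%R) <= e%:E)%E,
       `|\int[mu]_(t in `]0, 1]) s t - u 1| <= e & P s e]].

(** The approximating test functions are the primitives of s. They are close to u
    at 1 by assumption, hence close to u on any segment by increment_le. *)
Lemma Dirichlet0_of_approximable u : Dirichlet p w u ->
  approximable u (fun s _ => \int[mu]_(t in setT) s t = 0) -> Dirichlet0 p w u.
Proof.
move=> Du H; split => //.
have H' n : exists s : R -> R, exists2 phi : R -> R, test_function phi &
    [/\ phi^`() = s,
     (energy p w pos (fun t => (s t - derive1 u t)%R) <= (n.+1%:R^-1)%:E)%E &
      `|phi 1 - u 1| <= n.+1%:R^-1].
  have [|s [a [b [a0 ss s0 [Es s1 is0]]]]] := H n.+1%:R^-1; first by rewrite invr_gt0.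
  exists s; have [tphi phi's] := smooth_primitive_test a0 ss s0 is0.
  exists (fun x => \int[mu]_(t in `]-oo, x]) s t) => //; split => //.
  rewrite (_ : \int[mu]_(t in `]-oo, 1]) s t = \int[mu]_(t in `]0, 1]) s t)//.
  congr fine; apply: integral_support.
    by move=> t /=; rewrite !in_itv /= => /andP[].
  move=> t /=; rewrite !in_itv /= => -> /negP; rewrite andbT -leNgt => t0.
  by apply: s0 => /andP[h1 h2]; lra.
have [s /choice[phi Hphi]] : exists s : nat -> R -> R, forall n, exists phi : R -> R,
    test_function phi /\ [/\ phi^`() = s n,
     (energy p w pos (fun t => (s n t - derive1 u t)%R) <= (n.+1%:R^-1)%:E)%E &
      `|phi 1 - u 1| <= n.+1%:R^-1].
  have [s Hs] := choice H'; exists s => n.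
  by have [phi tphi Hphi] := Hs n; exists phi.
have small e : 0 < e -> \forall n \near \oo, n.+1%:R^-1 <= e.
  move=> e0; have := nbhs_infty_gerS e^-1; apply: filterS => n en.
  by rewrite invf_ple ?posrE.
have [acu [mu' u'fin]] := Du.
exists phi; split.
- by move=> n; case: (Hphi n).
- apply/(wLnorm_cvg0 hp w_gt0) => e e0; apply: filterS (small e e0) => n ne.
  have [_ [-> En _]] := Hphi n.
  apply: (@le_trans _ _ (n.+1%:R^-1)%:E); first exact: En.
  by rewrite lee_fin.
move=> K cK Kpos; apply/uniform_cvgP => e e0.
have [a [b [a0 a1 b1 Kab]]] := compact_pos_segment cK Kpos.
have mab : measurable (`[a, b] : set R) by exact: measurable_itv.
have abpos : (`[a, b] : set R) `<=` pos.
  by move=> t /=; rewrite !in_itv /= andbT => /andP[h _]; exact: lt_le_trans h.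
have sab : (\int[mu]_(t in `[a, b]) (dual_weight p w t)%:E < +oo)%E.
  by apply: (@dual_weight_integral_segment _ p w hp w_gt0 w_cont _ a b) => //; lra.
have e4 : 0 < e / 4 by lra.
have [d d0 Hd] := L1_small_of_energy hp w_gt0 w_cont mab abpos sab e4.
near=> n => t /Kab /=; rewrite in_itv /= => /andP[ta tb].
have [tphi [phi's En phi1]] := Hphi n.
have dphi := test_function_derivable tphi.
have cphi' := test_function_continuous1 tphi.
have nd : n.+1%:R^-1 <= d by near: n; exact: small.
have ne : n.+1%:R^-1 <= e / 4 by near: n; exact: small.
have mdf : measurable_fun pos (fun t => s n t - derive1 u t).
  apply: measurable_funB => //; rewrite -phi's.
  by apply: (@measurable_funS _ _ _ _ setT) => //; exact: continuous_measurable_fun.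
have L1 : (\int[mu]_(t in `[a, b]) (`|derive1 (phi n) t - derive1 u t|)%:E <= (e / 4)%:E)%E.
  have E1 := energy_subset p w_gt0 w_cont mab abpos mdf.
  rewrite phi's; apply: Hd; first exact: measurable_funS mdf.
  by apply: (le_trans E1); apply: (le_trans En); rewrite lee_fin.
have inc x y := @increment_le u (phi n) a b x y (e / 4) acu mu' dphi cphi' a0 L1.
have tri : `|(phi n t - u t) - (phi n 1 - u 1)| <= e / 4.
  have [t1|/ltW t1] := leP t 1; last exact: inc.
  by rewrite distrC; exact: inc.
rewrite distrC (_ : phi n t - u t = ((phi n t - u t) - (phi n 1 - u 1)) + (phi n 1 - u 1)); last by ring.
rewrite (le_lt_trans (ler_normD _ _))//.
have := le_trans phi1 ne; lra.
Unshelve. all: by end_near. Qed.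

Lemma tame_energy_lty D g : tame pos g -> measurable D -> D `<=` pos ->
  (energy p w D g < +oo)%E.
Proof.
move=> tg mD Dpos.
have [mg [a [b [M [a0 ab gM g0]]]]] := tg.
have M0 : 0 <= M by rewrite (le_trans _ (gM 0)).
have [m [W [m0 W0 HW]]] := weight_bounds w_gt0 w_cont a0 (ltW ab).
have abpos : (`]a, b] : set R) `<=` pos.
  by move=> t /=; rewrite !in_itv /= andbT => /andP[h _]; exact: lt_trans h.
apply: (@le_lt_trans _ _ (energy p w pos g)).
  by apply: energy_subset => //; exact: measurable_funS mg.
have -> : energy p w pos g = energy p w `]a, b]%classic g.
  apply: integral_support => // t pt nt; rewrite g0.
    by rewrite normr0 powR0 ?mul0r// gt_eqF// (lt_trans ltr01 hp).
  by move=> [_ h]; apply: nt; rewrite /= in_itv.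
apply: le_lt_trans (@energy_le_L1 _ p w hp w_gt0 w_cont _ W M _ _ _ _ _ _ _ _) _ => //.
- exact: measurable_funS mg.
- by move=> t /=; rewrite in_itv /= => /andP[/ltW h1 h2]; have [] := HW t => //; rewrite h1.
- exact: ltW.
rewrite lte_mul_pinfty ?lee_fin ?mulr_ge0 ?powR_ge0 ?(ltW W0)//.
have /integrableP[_] := tame_integrable (measurable_itv `]a, b]%R) tg.
by [].
Qed.

(** A small mean is compensated by a small multiple of a fixed bump supported in
    [1, 2], which does not affect the integral over ]0, 1]. *)
Lemma zero_mean_correction u : Dirichlet p w u ->
  approximable u (fun s e => `|\int[mu]_(t in setT) s t| <= e) ->
  approximable u (fun s _ => \int[mu]_(t in setT) s t = 0).
Proof.
move=> [_ [mu' u'fin]] H e e0.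
have P0 : 0 < 2 `^ p :> R by rewrite powR_gt0.
have P1 : 1 <= 2 `^ p :> R.
  have := @ler_powR R 2 _ 0 p; rewrite powRr0; apply; first by rewrite ler1n.
  exact: ltW (lt_trans ltr01 hp).
have h12 : (1 : R) <= 2 by lra.
have h20 : 0 < 2^-1 :> R by rewrite invr_gt0.
have [k k0 Hk] := bump_L1 h12 h20.
pose q : R -> R := bump 1 2 k.
have sq : smooth q by exact: smooth_bump.
have q0 : supported 1 2 q by move=> t nt; exact: bump_out.
have mq : measurable_fun setT q by exact: smooth_measurable.
have tq : tame pos q.
  split => //; exists 1, 2, 1; split; [exact: ltr01|lra| |].
    by move=> t; have /andP[h1 h2] := bump_01 1 2 t k0; rewrite ger0_norm.
  move=> t nt; apply: q0 => /andP[h1 h2]; apply: nt; split; last by rewrite h1 ltW.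
  by rewrite /= in_itv /= andbT; lra.
have iq : mu.-integrable setT (EFin \o q).
  by apply: integrable_compact_support q0; exact: smooth_continuous.
set B := \int[mu]_(t in setT) q t.
have B2 : 2^-1 <= B.
  have m12 : measurable (`]1, 2] : set R) by exact: measurable_itv.
  have BE : B%:E = (\int[mu]_(t in `]1%R, 2%R]) (q t)%:E)%E.
    rewrite /B /Rintegral fineK ?integrable_fin_num//.
    apply: integral_support => // t _ nt; apply: q0 => /andP[h1 h2].
    by apply: nt; rewrite /= in_itv /= h1 ltW.
  have q0' t : 0 <= q t by have /andP[] := bump_01 1 2 t k0.
  have : ((1 * (2 - 1))%:E <= \int[mu]_(t in `]1%R, 2%R]) ((`|1 - q t|)%:E + (q t)%:E))%E.
    rewrite -integral_cst_itvoc; last by lra.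
    have mn : measurable_fun (`]1, 2] : set R) (fun t => (`|1 - q t|)%:E).
      apply/measurable_EFinP; apply: measurableT_comp => //; apply: measurable_funB => //.
      exact: measurable_funS mq.
    have mq' : measurable_fun (`]1, 2] : set R) (fun t => (q t)%:E).
      by apply/measurable_EFinP; exact: measurable_funS mq.
    apply: ge0_le_integral => //; first exact: emeasurable_funD.
    move=> t _; rewrite -EFinD lee_fin.
    have := ler_norm (1 - q t); lra.
  rewrite ge0_integralD//=; last 3 first.
  - apply/measurable_EFinP; apply: measurableT_comp => //; apply: measurable_funB => //.
    exact: measurable_funS mq.
  - by move=> t _; rewrite lee_fin.
  - by apply/measurable_EFinP; exact: measurable_funS mq.
  rewrite -BE => h; have := le_trans h (leeD2r _ Hk).
  rewrite -EFinD lee_fin; lra.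
have B0 : 0 < B by lra.
have EqN : (energy p w pos q < +oo)%E by apply: tame_energy_lty.
have [E E0 EE] : exists2 E : R, 0 <= E & energy p w pos q = E%:E.
  exists (fine (energy p w pos q)); first by rewrite fine_ge0// energy_ge0.
  by rewrite fineK// ge0_fin_numE// energy_ge0.
have den0 : 0 < 2 `^ p * (1 + 2 * E) by rewrite mulr_gt0//; lra.
(* the coefficient k1 of the bump satisfies |k1| <= 2 e1 <= 1, so that |k1|^p <= 2 e1 *)
pose e1 := Num.min 2^-1 (e / (2 `^ p * (1 + 2 * E))).
have e10 : 0 < e1 by rewrite lt_min h20 divr_gt0.
have e1h : e1 <= 2^-1 by rewrite ge_min lexx.
have e1d : 2 `^ p * (1 + 2 * E) * e1 <= e.
  by rewrite mulrC -ler_pdivlMr// ge_min lexx orbT.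
have e1e : e1 <= e.
  apply: le_trans e1d; rewrite ler_peMl ?(ltW e10)//.
  by rewrite -[leLHS]mulr1 ler_pM//; lra.
have [s [a [b [a0 ss s0 [Es s1 sint]]]]] := H e1 e10.
have ints : mu.-integrable setT (EFin \o s).
  by apply: integrable_compact_support s0; exact: smooth_continuous.
have ms : measurable_fun setT s by exact: smooth_measurable.
pose k1 := - (\int[mu]_(t in setT) s t) / B.
have k1e : `|k1| <= 2 * e1.
  rewrite /k1 normrM normrN normfV (gtr0_norm B0) ler_pdivrMr//.
  apply: le_trans sint _; nra.
have sk1q : smooth (fun t => k1 * q t).
  by move=> n; apply: Cn_mul; [exact: Cn_cst|exact: sq].
have ikq : mu.-integrable setT (EFin \o (fun t => k1 * q t)).
  apply: (@integrable_compact_support _ _ 1 2); first exact: smooth_continuous.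
  by move=> t nt; rewrite q0 ?mulr0.
exists (fun t => s t + k1 * q t), (Num.min a 1), (Num.max b 2); split.
- by rewrite lt_min a0 ltr01.
- by move=> n; apply: Cn_add; [exact: ss|exact: sk1q].
- move=> t nt; rewrite s0 ?q0 ?mulr0 ?addr0// => /andP[h1 h2]; apply: nt.
    by rewrite gt_min lt_max h1 h2 !orbT.
  by rewrite gt_min lt_max h1 h2.
split.
- have m1 : measurable_fun pos (fun t => s t - derive1 u t).
    by apply: measurable_funB => //; exact: measurable_funS ms.
  have mqp : measurable_fun pos q by exact: measurable_funS mq.
  have m2 : measurable_fun pos (fun t => k1 * q t) by exact: measurable_funM.
  have mpos : measurable pos by exact: measurable_itv.
  have := energyD hp w_gt0 w_cont mpos (@subset_refl _ _) m1 m2.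
  rewrite (_ : (fun t => s t - derive1 u t + k1 * q t) =
               (fun t => s t + k1 * q t - derive1 u t)); last first.
    by apply/funext => t; ring.
  move=> /le_trans; apply.
  rewrite (energyZ p w_gt0 w_cont _ mpos (@subset_refl _ _) mqp) EE -EFinM.
  apply: (@le_trans _ _ ((2 `^ p)%:E * (e1 + 2 * e1 * E)%:E)%E).
    apply: lee_wpmul2l; first by rewrite lee_fin ltW.
    rewrite EFinD; apply: leeD => //; rewrite lee_fin ler_wpM2r//.
    apply: (@le_trans _ _ ((2 * e1) `^ p)).
      apply: ge0_ler_powR; rewrite ?nnegrE//; first exact: ltW (lt_trans ltr01 hp).
      by rewrite mulr_ge0// ltW.
    by apply: ge1r_powR; rewrite ?(ltW hp)//; apply/andP; split; lra.
  by rewrite -EFinM lee_fin; apply: le_trans e1d; rewrite le_eqVlt; apply/orP; left; apply/eqP; ring.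
- rewrite RintegralD//; last 2 first.
  + exact: integrableS ints.
  + exact: integrableS ikq.
  rewrite (_ : \int[mu]_(t in `]0, 1]) (k1 * q t) = 0) ?addr0; first exact: le_trans s1 e1e.
  rewrite (@eq_Rintegral _ _ _ _ _ (cst 0)) ?Rintegral_cst ?mul0r//.
  move=> t /set_mem /=; rewrite in_itv /= => /andP[h1 h2].
  by rewrite q0 ?mulr0// => /andP[]; lra.
- rewrite RintegralD//.
  rewrite RintegralZl// -/B /k1 divfK ?gt_eqF//; ring.
Qed.

(** The derivative of u is approximated separately on ]0, 1] and on ]1, +oo[, with
    integrals close to u 1 and - u 1, so that the total mean is small; the sum
    is then smoothed. *)
Lemma boundary_approximable u : Dirichlet p w u ->
  ~ Bp0 p w \/ (mu.-integrable `]0, 1] (EFin \o u^`()) /\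
    \int[mu]_(t in `]0, 1]) (u^`())%classic t = u 1) ->
  ~ Bpinfty p w \/ (mu.-integrable `]1, +oo[ (EFin \o u^`()) /\
    \int[mu]_(t in `]1, +oo[) (u^`())%classic t = - u 1) ->
  approximable u (fun s e => `|\int[mu]_(t in setT) s t| <= e).
Proof.
move=> Du HL HR e e0; have [_ [mu' u'fin]] := Du.
have P0 : 0 < 2 `^ p :> R by rewrite powR_gt0.
pose DL : set R := `]0, 1]%classic; pose DR : set R := `]1, +oo[%classic.
have mL : measurable DL by exact: measurable_itv.
have mR : measurable DR by exact: measurable_itv.
have mpos : measurable pos by exact: measurable_itv.
have Lpos : DL `<=` pos by move=> t; rewrite /DL /= !in_itv /= andbT => /andP[].
have Rpos : DR `<=` pos by move=> t; rewrite /DR /= !in_itv /= !andbT; exact: lt_trans.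
have LR : DL `|` DR = pos by rewrite -itv_bndbnd_setU// bnd_simp.
have dLR : [disjoint DL & DR].
  apply/disj_setPS => t [] /=; rewrite /DL /DR /= !in_itv /= andbT => /andP[_ h1] h2.
  by have := le_lt_trans h1 h2; rewrite ltxx.
have Eu : (energy p w pos u^`() < +oo)%E by exact: wLnorm_lty u'fin.
have muL : measurable_fun DL u^`() by exact: measurable_funS mu'.
have muR : measurable_fun DR u^`() by exact: measurable_funS mu'.
have EL : (energy p w DL u^`() < +oo)%E by apply: le_lt_trans Eu; exact: energy_subset.
have ER : (energy p w DR u^`() < +oo)%E by apply: le_lt_trans Eu; exact: energy_subset.
have {}HL : (\int[mu]_(t in DL) (dual_weight p w t)%:E = +oo)%E \/
    (mu.-integrable DL (EFin \o u^`()) /\ \int[mu]_(t in DL) (u^`())%classic t = u 1).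
  case: HL => [nB|]; [left|by right].
  by apply/eqP; rewrite -leye_eq leNgt; apply/negP.
have {}HR : (\int[mu]_(t in DR) (dual_weight p w t)%:E = +oo)%E \/
    (mu.-integrable DR (EFin \o u^`()) /\ \int[mu]_(t in DR) (u^`())%classic t = - u 1).
  case: HR => [nB|]; [left|by right].
  apply/eqP; rewrite -leye_eq leNgt; apply/negP => h; apply: nB.
  rewrite /Bpinfty /= -integral_itv_obnd_cbnd//.
  by apply/measurable_EFinP; exact: measurable_dual_weight.
have [d [d0 de dp']] : exists d, [/\ 0 < d, d <= e / 3 & d <= e / 2 `^ p / 3].
  exists (Num.min (e / 3) (e / 2 `^ p / 3)).
  by split; [rewrite lt_min !divr_gt0|rewrite ge_min lexx|rewrite ge_min lexx orbT].
have dp : 2 `^ p * (d + (d + d)) <= e.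
  rewrite mulrC -ler_pdivlMr//; move: dp'; move: (e / 2 `^ p) => X; lra.
have [gL [tL eL cL]] := half_approximation hp w_gt0 w_cont mL Lpos muL EL HL d0.
have [gR [tR eR cR]] := half_approximation hp w_gt0 w_cont mR Rpos muR ER HR d0.
have tg := tame_add tL tR; rewrite LR in tg.
set g := (fun t => gL t + gR t) in tg.
have gLE t : DL t -> g t = gL t.
  move=> Lt; rewrite /g; have [_ [a [b [M [_ _ _ gR0]]]]] := tR.
  by rewrite gR0 ?addr0// => -[Rt _]; have /disj_setPS/(_ t) := dLR; apply.
have gRE t : DR t -> g t = gR t.
  move=> Rt; rewrite /g; have [_ [a [b [M [_ _ _ gL0]]]]] := tL.
  by rewrite gL0 ?add0r// => -[Lt _]; have /disj_setPS/(_ t) := dLR; apply.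
have mg := tg.1.
have Eg : (energy p w pos (fun t => (g t - derive1 u t)%R) <= (d + d)%:E)%E.
  have mdf : measurable_fun pos (fun t => g t - derive1 u t).
    by apply: measurable_funB => //; exact: measurable_funS mg.
  rewrite /energy -LR ge0_integral_setU//; last 2 first.
  - by rewrite LR; exact: measurable_energy.
  - move=> t; rewrite LR /= in_itv /= andbT => t0.
    by rewrite lee_fin mulr_ge0 ?powR_ge0// ltW// w_gt0.
  rewrite EFinD; apply: leeD.
    apply: le_trans eL; rewrite le_eqVlt; apply/orP; left; apply/eqP.
    by apply: eq_integral => t /set_mem Lt; rewrite gLE.
  apply: le_trans eR; rewrite le_eqVlt; apply/orP; left; apply/eqP.
  by apply: eq_integral => t /set_mem Rt; rewrite gRE.
have [s [a [b [a0 ss s0 Es L1s]]]] := tame_smooth hp w_gt0 w_cont tg d0.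
have ms : measurable_fun setT s by exact: smooth_measurable.
have ints : mu.-integrable setT (EFin \o s).
  by apply: integrable_compact_support s0; exact: smooth_continuous.
have near_int D : measurable D -> D `<=` pos ->
    `|\int[mu]_(t in D) s t - \int[mu]_(t in D) g t| <= d.
  move=> mD Dpos.
  have iD : mu.-integrable D (EFin \o s) by exact: integrableS ints.
  have igD : mu.-integrable D (EFin \o g) := tame_integrable mD tg.
  rewrite -RintegralB//.
  have idf := @integrableB _ _ _ mu _ mD _ _ iD igD.
  apply: (normr_Rintegral_le mD idf).
  apply: le_trans L1s; apply: ge0_subset_integral => //.
  apply/measurable_EFinP; apply: measurableT_comp => //.
  by apply: measurable_funB; [exact: measurable_funS ms|exact: measurable_funS mg].
have gL1 : \int[mu]_(t in DL) g t = \int[mu]_(t in DL) gL t.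
  by apply: eq_Rintegral => t /set_mem /gLE.
have gR1 : \int[mu]_(t in DR) g t = \int[mu]_(t in DR) gR t.
  by apply: eq_Rintegral => t /set_mem /gRE.
exists s, a, b; split => //; split.
- have m1 : measurable_fun pos (fun t => s t - g t).
    by apply: measurable_funB; [exact: measurable_funS ms|exact: measurable_funS mg].
  have m2 : measurable_fun pos (fun t => g t - derive1 u t).
    by apply: measurable_funB => //; exact: measurable_funS mg.
  have := energyD hp w_gt0 w_cont mpos (@subset_refl _ _) m1 m2.
  rewrite (_ : (fun t => s t - g t + (g t - derive1 u t)) =
               (fun t => s t - derive1 u t)); last first.
    by apply/funext => t; ring.
  move=> /le_trans; apply.
  apply: (@le_trans _ _ ((2 `^ p)%:E * (d + (d + d))%:E)%E).
    apply: lee_wpmul2l; first by rewrite lee_fin ltW.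
    by rewrite EFinD; apply: leeD.
  by rewrite -EFinM lee_fin.
- rewrite (_ : _ - u 1 = (\int[mu]_(t in DL) s t - \int[mu]_(t in DL) g t) +
     (\int[mu]_(t in DL) gL t - u 1)); last by rewrite gL1; ring.
  apply: le_trans (ler_normD _ _) _.
  by apply: le_trans (lerD (near_int _ mL Lpos) cL) _; lra.
- have -> : \int[mu]_(t in setT) s t = \int[mu]_(t in pos) s t.
    congr fine; apply: integral_support => // t _ nt; apply: s0 => /andP[h1 h2].
    by apply: nt; rewrite /= in_itv /= andbT; lra.
  have -> : \int[mu]_(t in pos) s t = (\int[mu]_(t in pos) s t - \int[mu]_(t in pos) g t) +
     ((\int[mu]_(t in DL) gL t - u 1) + (\int[mu]_(t in DR) gR t - - u 1)).
    rewrite -gL1 -gR1 -[in \int[mu]_(t in pos) g t]LR Rintegral_setU//; first by ring.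
    by rewrite LR; exact: tame_integrable mpos tg.
  apply: le_trans (ler_normD _ _) _.
  have cLR := le_trans (ler_normD _ _) (lerD cL cR).
  by apply: le_trans (lerD (near_int _ mpos (@subset_refl _ _)) cLR) _; lra.
Qed.

(** Both u n = u 1 + (integral of u' over ]1, n]) and u n = (integral of v over
    [n, +oo[) hold; the latter tends to 0 as n tends to infinity. *)
Lemma Rinfty_boundary u : Bpinfty p w -> Rinfty p w u ->
  mu.-integrable `]1, +oo[ (EFin \o u^`()) /\
    \int[mu]_(t in `]1, +oo[) (u^`())%classic t = - u 1.
Proof.
move=> B [Du [v _ uv]]; have [acu [mu' _]] := Du.
pose D : set R := `]1, +oo[%classic.
have mD : measurable D by exact: measurable_itv.
have Dpos : D `<=` pos by move=> t; rewrite /D /= !in_itv /= !andbT; exact: lt_trans.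
have sD : (\int[mu]_(t in D) (dual_weight p w t)%:E < +oo)%E.
  rewrite /D integral_itv_obnd_cbnd//.
  by apply/measurable_EFinP; exact: measurable_dual_weight.
have iu := Dirichlet_integrable hp w_gt0 w_cont Du mD Dpos sD.
split => //.
pose A n : set R := `]1, n.+1%:R]%classic.
have mA n : measurable (A n) by exact: measurable_itv.
have cA t : D t -> \forall n \near \oo, A n t.
  rewrite /D /= in_itv /= andbT => t1.
  by apply: filterS (nbhs_infty_gerS t) => n tn; rewrite /A /= in_itv /= t1.
have AD n : A n `<=` D by move=> t; rewrite /A /D /= !in_itv /= andbT => /andP[].
have cut f n : \int[mu]_(t in D) (f \_ (A n)) t = \int[mu]_(t in A n) f t.
  transitivity (\int[mu]_(t in A n) (f \_ (A n)) t).
    by congr fine; apply: integral_support => // t _ nt; rewrite patchE memNset.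
  by apply: eq_Rintegral => t At; rewrite patchE At.
have n1 n : (1 : R) <= n.+1%:R by rewrite ler1n.
have cu := integral_exhaust mD mA cA iu.
have iv : mu.-integrable D (EFin \o v).
  have [iv _] := uv 1 ltr01; apply: integrableS iv => //.
  by move=> t; rewrite /D /= !in_itv /= !andbT; exact: ltW.
have cv := integral_exhaust mD mA cA iv.
have uE n : \int[mu]_(t in D) (derive1 u \_ (A n)) t = u n.+1%:R - u 1.
  by rewrite cut; have [_ ->] := loc_abs_cont_FTC acu mu' ltr01 (n1 n).
have vE n : \int[mu]_(t in D) v t - \int[mu]_(t in D) (v \_ (A n)) t = u n.+1%:R.
  have n0 : 0 < n.+1%:R :> R by [].
  have [ivn ->] := uv _ n0.
  rewrite cut Rintegral_itvB//; last by rewrite bnd_simp.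
  rewrite Rintegral_itv_obnd_cbnd//; apply: integrableS ivn => //.
  by move=> t /=; rewrite !in_itv /= !andbT; exact: ltW.
have u0 : u n.+1%:R @[n --> \oo] --> 0.
  under eq_fun do rewrite -vE.
  by rewrite -(subrr (\int[mu]_(t in D) v t)); apply: cvgB => //; exact: cvg_cst.
have u1 : (\int[mu]_(t in D) (derive1 u \_ (A n)) t) @[n --> \oo] --> 0 - u 1.
  under eq_fun do rewrite uE.
  by apply: cvgB => //; exact: cvg_cst.
by rewrite -[RHS]sub0r; apply: cvg_unique cu u1; exact: Rhausdorff.
Qed.

(** At each end of the half-line, either the dual weight is not integrable and
    boundary values are free, or u must be recovered from its derivative by
    integration from that end. *)
Lemma Dirichlet0_of_boundary u : Dirichlet p w u ->
  ~ Bp0 p w \/ Rzero p w u -> ~ Bpinfty p w \/ (Bpinfty p w /\ Rinfty p w u) ->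
  Dirichlet0 p w u.
Proof.
move=> Du HL HR; apply: Dirichlet0_of_approximable => //.
apply: zero_mean_correction => //; apply: boundary_approximable => //.
  case: HL => [|[_ /(_ 1 ltr01) [i ->]]]; [by left|by right].
case: HR => [|[B Ru]]; [by left|by right; exact: Rinfty_boundary].
Qed.

End assembly.

Local Open Scope ring_scope.

Theorem theorem4p3 (R : realType) (p : R) (w : R -> R)
    (hp : 1 < p)
    (w_gt0 : forall t : R, 0 < t -> 0 < w t)
    (w_cont : {within `]0, +oo[, continuous w}) :
  [/\ (Bp0 p `\` Bpinfty p) w -> Dirichlet0 p w = Rzero p w,
      (Bpinfty p `\` Bp0 p) w -> Dirichlet0 p w = Rinfty p w,
      ~ (Bp0 p `|` Bpinfty p) w -> Dirichlet0 p w = Dirichlet p w &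
      (Bp0 p `&` Bpinfty p) w -> Dirichlet0 p w = Rzero p w `&` Rinfty p w].
Proof.
split.
- move=> [B nB]; apply/seteqP; split => u; first exact: Dirichlet0_Rzero.
  by move=> Ru; apply: Dirichlet0_of_boundary => //; [case: Ru|right|left].
- move=> [B nB]; apply/seteqP; split => u; first exact: Dirichlet0_Rinfty.
  by move=> Ru; apply: Dirichlet0_of_boundary => //; [case: Ru|left|right].
- move=> nB; apply/seteqP; split => u; first by case.
  by move=> Du; apply: Dirichlet0_of_boundary => //; left => B; apply: nB; [left|right].
- move=> [B0 Boo]; apply/seteqP; split => u.
    by move=> Du; split; [exact: Dirichlet0_Rzero|exact: Dirichlet0_Rinfty].
  by move=> [R0 Roo]; apply: Dirichlet0_of_boundary => //; [case: R0|right|right].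
Qed.
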